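(* Let $q\in L_2(0,\pi)$ be real-valued, $h,H,H_1,H_2\in\mathbb{R}$ with $\rho:=HH_1-H_2>0$, and let $\lambda_0<\lambda_1<\lambda_2<\dots$ and $\{\gamma_n\}_{n\ge 0}$ be the eigenvalues and norming constants of the problem $\mathcal{P}(q,h,H,H_1,H_2)$. Then there exist sequences $\{\zeta_n\},\{\zeta'_n\}\in l_2$ such that, for $n\ge1$, $$\sqrt{\lambda_n}=n-1+\frac{\omega}{n\pi}+\frac{\zeta_n}{n},\qquad \gamma_n=\frac{\pi}{2}+\frac{\zeta'_n}{n},$$ where $$\omega=h+H+\frac12\int_0^\pi q(x)\,dx.$$
   Context: $\mathcal{P}(q,h,H,H_1,H_2)$ denotes the eigenvalue problem $$-y''(x)+q(x)y(x)=\lambda y(x),\quad x\in[0,\pi],$$ $$y'(0)-hy(0)=0,\qquad \lambda\,(y'(\pi)+Hy(\pi))=H_1y'(\pi)+H_2y(\pi).$$ Its eigenvalues form a countably infinite set of real numbers, all simple. Let $\varphi(x,\lambda)$ be the solution of the equation with $\varphi(0,\lambda)=1$, $\varphi'(0,\lambda)=h$. The norming constants are $$\gamma_n:=\int_0^\pi\varphi^2(x,\lambda_n)\,dx+\frac{(\varphi'(\pi,\lambda_n)+H\varphi(\pi,\lambda_n))^2}{\rho}.$$ For $\lambda_n<0$ the square root is purely imaginary; the sequences in $l_2$ may be complex. *)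

(* Defs.v *)
From HB Require Import structures.
From mathcomp Require Import all_boot all_order all_algebra.
From mathcomp Require Import all_classical all_reals all_analysis.
From mathcomp Require Import complex.

Set Implicit Arguments.
Unset Strict Implicit.
Unset Printing Implicit Defensive.

Import Order.TTheory GRing.Theory Num.Theory.
Import numFieldNormedType.Exports.

Local Open Scope classical_set_scope.
Local Open Scope ring_scope.

Section Defs.
Context {R : realType}.
Implicit Types (q f y dy : R -> R) (h H lam : R).

Local Notation mu := (@lebesgue_measure R).

(* Real-valued L_2(0, pi); integrability of q^2 alone would not give the
   measurability of q. *)
Definition L2_0pi q : Prop :=
  measurable_fun `]0, pi[%classic q /\
  mu.-integrable `]0, pi[%classic (fun x => (q x ^+ 2)%:E).

(* Derivative of f at x relative to the set D: one-sided at the end-points when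
   D is an interval, so that the values of f outside D do not matter. *)
Definition derivative_in (D : set R) f (x d : R) : Prop :=
  (f z - f x) / (z - x) @[z --> within D x^'] --> d.

Definition abs_continuous (a b : R) f : Prop :=
  forall e : R, 0 < e -> exists2 d : R, 0 < d &
    forall (n : nat) (l r : 'I_n -> R),
      (forall i, [/\ a <= l i, l i <= r i & r i <= b]) ->
      (forall i j, i != j -> r i <= l j \/ r j <= l i) ->
      \sum_(i < n) (r i - l i) < d ->
      \sum_(i < n) `|f (r i) - f (l i)| < e.

(* Solutions of - y'' + q y = lam y on [0, pi] with q only in L_2, in the usual
   (Caratheodory) sense: y is differentiable with absolutely continuous
   derivative dy, and the equation holds almost everywhere. *)
Definition SL_solution q lam y dy : Prop :=
  [/\ forall x : R, x \in `[0, pi] -> derivative_in `[0, pi]%classic y x (dy x),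
      abs_continuous 0 pi dy &
      {ae mu, forall x : R, x \in `[0, pi] ->
        exists2 ddy, derivative_in `[0, pi]%classic dy x ddy &
          - ddy + q x * y x = lam * y x}].

Definition SL_eigenvalue q h H H1 H2 lam : Prop :=
  exists y dy : R -> R,
    [/\ SL_solution q lam y dy,
        exists2 x, x \in `[0, pi] & y x != 0,
        dy 0 - h * y 0 = 0 &
        lam * (dy pi + H * y pi) = H1 * dy pi + H2 * y pi].

(* The norming constant of the function phi = phi(., lambda_n), whose derivative
   is dphi; the denominator is rho = H H1 - H2. *)
Definition norming_constant H H1 H2 (phi dphi : R -> R) : R :=
  \int[mu]_(x in `[0, pi]) (phi x ^+ 2) +
  (dphi pi + H * phi pi) ^+ 2 / (H * H1 - H2).

Definition l2_seq (z : nat -> R[i]) : Prop :=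
  (\sum_(n <oo) (Normc.normc (z n) ^+ 2)%:E < +oo)%E.

Definition omega q h H : R :=
  h + H + 2^-1 * \int[mu]_(x in `[0, pi]) q x.

End Defs.

(* Main.v *)
(* The angle th of the vector (phi', phi) satisfies th' = cos^2 th + (lam - q) sin^2 th,
   so th(pi, lam) is continuous and nondecreasing in lam.  The boundary condition at pi
   reads sin(th(pi, lam) - b(lam)) = 0 for an explicit continuous decreasing b, and
   th(pi, lam) - b(lam) stays above -pi, is negative for some lam, and is unbounded above.
   Hence it equals n pi exactly at lam = lambda_n, which numbers the eigenvalues without
   complex analysis.  For lam = s^2 the angle psi of (phi', s phi) stays within pi/2 of th
   and satisfies psi' = s - (q/s) sin^2 psi, so psi = s x + pi/2 + O(1/s); integrating over
   [0, pi] at the eigenvalue lambda_(n+1) = s^2 gives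
     pi (s - n) = (omega + (1/2) int q cos(2 s x)) / s + O(1/s^2).
   Integrating the derivative of (x - pi)(phi^2 + phi'^2/s^2) - phi phi'/s^2 gives
     int phi^2 = pi/2 - (1/(2 s)) int (pi - x) q sin(2 s x) + O(1/s^2).
   The remaining integrals are, up to O(1/n), coefficients of L_2 functions in the
   orthogonal systems cos(2 n x) and sin(2 n x), hence square summable by Bessel. *)

Require Import Defs.
From HB Require Import structures.
From mathcomp Require Import all_boot all_order all_algebra.
From mathcomp Require Import all_classical all_reals all_analysis.
From mathcomp Require Import complex.
From mathcomp Require Import measurable_realfun ring lra.

Set Implicit Arguments.
Unset Strict Implicit.
Unset Printing Implicit Defensive.

Import Order.TTheory GRing.Theory Num.Theory.
Import numFieldNormedType.Exports.

Local Open Scope classical_set_scope.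
Local Open Scope ring_scope.

(** * Absolutely continuous functions *)

Section AbsolutelyContinuous.
Context {R : realType}.
Local Notation mu := (@lebesgue_measure R).
Implicit Types (f g : R -> R) (a b : R).

(** With q only in L_2, phi' is differentiable merely almost everywhere, so no pointwise mean value
    theorem applies to it. The substitute is [ac_derive_le]: an absolutely continuous function with
    derivative nonnegative almost everywhere is nondecreasing. The fundamental theorem, Gronwall's
    inequality, the comparison of angles and the energy bounds are derived from it. Two angles are
    needed. The first exists for every real lam, negative ones included, and can number the
    eigenvalues, but its equation contains no small perturbation. The second has the perturbation
    q/s, but needs lam = s^2 > 0, and the boundary condition at pi gives it only modulo pi. The
    distance below pi/2 between the two, with the sign of phi(pi), fixes the multiple of pi. The
    precision sought is O(1/s^2) plus 1/s times a Fourier-type coefficient: multiplied by n, the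
    first part is O(1/n), hence square summable. The constants must therefore be independent of n.
    The coefficients arise at frequency s; Lipschitz dependence on s and s - n = O(1/n) move them to
    n. *)

Lemma ae_andP (P Q : R -> Prop) :
  {ae mu, forall x, P x} -> {ae mu, forall x, Q x} ->
  {ae mu, forall x, P x /\ Q x}.
Proof.
move=> HP HQ.
by apply: (@filterS2 _ _ (ae_filter_ringOfSetsType mu) _ _ _ _ HP HQ) => x; split.
Qed.

Lemma ae_imply (P Q : R -> Prop) : (forall x, P x -> Q x) ->
  {ae mu, forall x, P x} -> {ae mu, forall x, Q x}.
Proof.
move=> PQ HP.
by apply: (@filterS _ _ (ae_filter_ringOfSetsType mu) _ _ _ HP) => x /PQ.
Qed.

(** Half-open intervals, because those in the definition of absolute continuity may share
    end-points. *)
Lemma trivIset_nonoverlapping n (l r : 'I_n -> R) :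
  (forall i j, i != j -> r i <= l j \/ r j <= l i) ->
  trivIset setT (fun i => `]l i, r i]%classic).
Proof.
move=> no; apply/trivIsetP => i j _ _ ij; rewrite -subset0 => x [] /=.
rewrite !in_itv /= => /andP[h1 h2] /andP[h3 h4].
by case: (no _ _ ij) => h; lra.
Qed.

Lemma measure_nonoverlapping n (l r : 'I_n -> R) :
  (forall i, l i <= r i) ->
  (forall i j, i != j -> r i <= l j \/ r j <= l i) ->
  (mu (\big[setU/set0]_(i < n) `]l i, r i]%classic)
   = (\sum_(i < n) (r i - l i))%:E)%E.
Proof.
move=> lr no; rewrite (@measure_bigsetU_ord _ _ _ mu n xpredT
  (fun i : 'I_n => `]l i, r i]%classic)) //; last exact: trivIset_nonoverlapping.
rewrite -sumEFin; apply: eq_bigr => i _.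
rewrite [LHS]lebesgue_measure_itv /= lte_fin; case: ltP => // h.
by rewrite (_ : l i = r i) ?subrr //; apply/le_anti/andP.
Qed.

Lemma sum_nonoverlapping_le (U : set R) n (l r : 'I_n -> R) : open U ->
  (forall i, l i <= r i) ->
  (forall i j, i != j -> r i <= l j \/ r j <= l i) ->
  (forall i, `]l i, r i] `<=` U) ->
  ((\sum_(i < n) (r i - l i))%:E <= mu U)%E.
Proof.
move=> oU lr no sub; rewrite -measure_nonoverlapping //.
apply: le_measure; rewrite ?inE //=.
- by apply: bigsetU_measurable => i _; exact: measurable_itv.
- exact: open_measurable.
by apply: (big_ind (fun A => A `<=` U)) => // A B AU BU x [/AU|/BU].
Qed.

Lemma is_derive_near_slope f (x d e : R) : is_derive x 1 f d -> 0 < e ->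
  exists2 dl : R, 0 < dl &
    forall z, `|z - x| < dl -> `|f z - f x - d * (z - x)| <= e * `|z - x|.
Proof.
move=> /is_derive1_caratheodory [k [fE kc <-]] e0.
have /cvgrPdist_le /(_ _ e0) := kc.
move=> [dl /= dl0 H]; exists dl => // z zx.
rewrite fE -mulrBl normrM ler_wpM2r // distrC; apply: H.
by rewrite /ball_ /= distrC.
Qed.

(** Absolute continuity is what lets a derivative known almost everywhere control increments, so the
    two facts travel together through sums, products and compositions. *)
Definition ac_derive a b f g : Prop :=
  abs_continuous a b f /\
  {ae mu, forall x, x \in `]a, b[ -> is_derive x 1 f (g x)}.

(* Continuous induction: x is reached when f a - f x is at most e (x - a), up to
   the variation of f over finitely many intervals contained in an open set of
   small measure that covers the exceptional points.  Absolute continuity makes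
   that variation small. *)
Lemma ac_derive_le a b f g : a <= b -> ac_derive a b f g ->
  {ae mu, forall x, x \in `]a, b[ -> 0 <= g x} -> f a <= f b.
Proof.
move=> ab [acf df] g0.
rewrite -subr_le0; apply/ler_addgt0Pr => e0 e00; rewrite add0r.
pose e := e0 / (b - a + 1).
have ba1 : 0 < b - a + 1 by rewrite ltr_wpDl ?subr_ge0.
have e_gt0 : 0 < e by rewrite divr_gt0.
have eE : e0 = e * (b - a) + e.
  by rewrite -[X in _ + X]mulr1 -mulrDr /e divfK ?gt_eqF.
have [d d0 acd] := acf _ e_gt0.
have [A [mA muA Asub]] := ae_andP df g0.
(* The end-points join the exceptional set because the derivative is known only in the open
   interval. *)
pose B := A `|` ([set a] `|` [set b]).
have mB : measurable B by do ![apply: measurableU => //].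
have muB : mu B = 0%E.
  have mu1 c : mu [set c] = 0%E by exact: lebesgue_measure_set1.
  have mab : mu ([set a] `|` [set b]) = 0%E.
    by apply: (null_set_setU _ _ (mu1 a) (mu1 b)).
  by apply: (null_set_setU _ _ muA mab) => //; exact: measurableU.
have [U [oU BU muU]] :
    exists U : set R, [/\ open U , B `<=` U & (mu U < d%:E)%E].
  have fB : (mu B < +oo)%E by rewrite muB ltry.
  have [U [oU BU muU]] := lebesgue_regularity_outer mB fB d0.
  exists U; split => //; have mU : measurable U by exact: open_measurable.
  by rewrite (measureDI mu mU mB) (setIidr BU) [X in (_ + X)%E]muB adde0.
pose P x := exists n (l r : 'I_n -> R),
  [/\ forall i, [/\ a <= l i, l i <= r i & r i <= x],
      forall i j, i != j -> r i <= l j \/ r j <= l i,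
      forall i, `]l i, r i] `<=` U &
      f a - f x <= e * (x - a) + \sum_(i < n) `|f (r i) - f (l i)|].
have Pa : P a.
  exists 0%N, (fun _ => a), (fun _ => a); split => //; first by case.
    by case.
  by rewrite big_ord0 !subrr mulr0 addr0.
(* One local step serves every c, in particular the supremum of the reached points. An exceptional c
   is crossed by appending []u, v]], contained in U; at any other c the derivative g c >= 0 controls
   both sides. *)
have step c : a <= c <= b -> exists2 dl : R, 0 < dl & forall u v,
    a <= u <= c -> c <= v <= b -> c - dl < u -> v < c + dl -> P u -> P v.
  move=> /andP[ac cb]; have [Bc|nBc] := pselect (B c).
    have [dl /= dl0 dlU] : \forall z \near c, U z.
      by apply: open_nbhs_nbhs; split => //; exact: BU.
    exists dl => // u v /andP[au uc] /andP[cv vb] dlu dlv.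
    move=> [n [l [r [lr no lU fE]]]].
    exists n.+1, (fun i => oapp l u (unlift ord0 i)),
      (fun i => oapp r v (unlift ord0 i)); split.
    - move=> i; case: unliftP => [j _|_] /=; last by split => //; lra.
      by have [h1 h2 h3] := lr j; split => //; lra.
    - move=> i j; case: unliftP => [i' ->|->]; case: unliftP => [j' ->|->] //=.
      + by rewrite (inj_eq lift_inj); exact: no.
      + by move=> _; left; have [] := lr i'.
      + by move=> _; right; have [] := lr j'.
    - move=> i; case: unliftP => [j _|_] //= z /=.
      rewrite in_itv /= => /andP[uz zv]; apply: dlU.
      by rewrite /= ltr_norml; apply/andP; split; lra.
    - rewrite big_ord_recl unlift_none /=.
      under eq_bigr do rewrite liftK /=.
      have h1 := ler_norm (f u - f v); rewrite distrC in h1.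
      have h2 : e * (u - a) <= e * (v - a) by rewrite ler_pM2l //; lra.
      by lra.
  have Pc : c \in `]a, b[.
    rewrite in_itv /=; apply/andP; split; rewrite lt_neqAle ?ac ?cb andbT.
      by apply/eqP => h; apply: nBc; right; left.
    by apply/eqP => h; apply: nBc; right; right.
  have [|fc gc] := (contra_notP (Asub c)) _; first by move=> Ac; apply: nBc; left.
  have [dl dl0 H] := is_derive_near_slope (fc Pc) e_gt0.
  exists dl => // u v /andP[au uc] /andP[cv vb] dlu dlv.
  move=> [n [l [r [lr no lU fE]]]]; exists n, l, r; split => //.
    by move=> i; have [h1 h2 h3] := lr i; split => //; lra.
  have hu : f u - f c <= e * (c - u).
    have := H u; have -> : `|u - c| = c - u by rewrite ler0_norm ?opprB ?subr_le0.
    have -> : c - u < dl by lra.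
    move=> /(_ isT); rewrite ler_norml => /andP[_]; have := gc Pc.
    by move=> gc0; have : 0 <= g c * (c - u); [rewrite mulr_ge0 ?subr_ge0|lra].
  have hv : f c - f v <= e * (v - c).
    have := H v; rewrite [`|v - c|]ger0_norm ?subr_ge0 //.
    have -> : v - c < dl by lra.
    move=> /(_ isT); rewrite ler_norml => /andP[+ _]; have := gc Pc.
    by move=> gc0; have : 0 <= g c * (v - c); [rewrite mulr_ge0 ?subr_ge0|lra].
  by lra.
pose S := [set x | a <= x <= b /\ P x].
have Sa : S a by split => //; rewrite lexx.
have ubS : ubound S b by move=> x [/andP[]].
have supS : has_sup S by split; [exists a|exists b].
have aS : a <= sup S by apply: ub_le_sup => //; exists b.
have Sb : sup S <= b by apply: ge_sup => //; exists a.
have [|dl dl0 H] := step (sup S); first by rewrite aS.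
have [u [/andP[au ub] Pu] dlu] := sup_adherent dl0 supS.
have uS : u <= sup S by apply: ub_le_sup; [exists b|split => //; rewrite au].
pose v := Num.min b (sup S + dl / 2).
have vle : v <= sup S + dl / 2 by rewrite ge_min lexx orbT.
have vb : v <= b by rewrite ge_min lexx.
have Sv : sup S <= v by rewrite le_min Sb; lra.
have Pv : P v by apply: (H u v) => //; rewrite ?au ?Sv //; lra.
have vS : v <= sup S.
  by apply: ub_le_sup; [exists b|split => //; rewrite vb (le_trans aS)].
have bv : v = b.
  by move: vS; rewrite /v; case: (leP b (sup S + dl / 2)) => h; lra.
move: Pv; rewrite bv => -[n [l [r [lr no lU fE]]]].
have : \sum_(i < n) (r i - l i) < d.
  rewrite -lte_fin; apply: le_lt_trans muU; apply: sum_nonoverlapping_le => // i.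
  by have [] := lr i.
by move=> /(acd _ _ _ lr no); lra.
Qed.

Lemma abs_continuous_sub a b c d f : a <= c -> d <= b ->
  abs_continuous a b f -> abs_continuous c d f.
Proof.
move=> ac db acf e /acf [dl dl0 H]; exists dl => // n l r lr no; apply: H => // i.
by have [h1 h2 h3] := lr i; split => //; lra.
Qed.

(** A single criterion behind the closure properties. The factor [|L| + 1] makes the division
    legitimate for every L, and f and g each receive half of e. *)
Lemma abs_continuous_dom2 a b f g (F : R -> R) (L : R) :
  abs_continuous a b f -> abs_continuous a b g ->
  (forall x y, x \in `[a, b] -> y \in `[a, b] ->
     `|F x - F y| <= L * (`|f x - f y| + `|g x - g y|)) ->
  abs_continuous a b F.
Proof.
move=> acf acg HL e e0.
have L1 : 0 < 2 * (`|L| + 1) by have := normr_ge0 L; lra.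
have e' : 0 < e / (2 * (`|L| + 1)) by rewrite divr_gt0.
have [df df0 Hf] := acf _ e'; have [dg dg0 Hg] := acg _ e'.
exists (Num.min df dg) => [|n l r lr no]; first by rewrite lt_min df0.
rewrite lt_min => /andP[/(Hf _ _ _ lr no) sf /(Hg _ _ _ lr no) sg].
apply: (@le_lt_trans _ _ (\sum_(i < n)
    (`|L| + 1) * (`|f (r i) - f (l i)| + `|g (r i) - g (l i)|))).
  apply: ler_sum => i _; have [h1 h2 h3] := lr i.
  apply: (le_trans (HL _ _ _ _)); rewrite ?in_itv /=; try (apply/andP; split); try lra.
  by apply: ler_wpM2r; rewrite ?addr_ge0 //; have := ler_norm L; lra.
rewrite -mulr_sumr big_split /=.
have -> : e = (`|L| + 1) * (e / (2 * (`|L| + 1)) + e / (2 * (`|L| + 1))).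
  by field; rewrite gt_eqF //; have := normr_ge0 L; lra.
by rewrite ltr_pM2l; [lra|have := normr_ge0 L; lra].
Qed.

Lemma abs_continuous_continuous a b f : abs_continuous a b f ->
  {within `[a, b], continuous f}.
Proof.
move=> acf; apply/subspace_continuousP => x /=; rewrite in_itv /= => /andP[ax xb].
apply/cvgrPdist_lt => e /acf [d d0 H].
exists d => //= y /= xy; rewrite in_itv /= => /andP[ay yb].
have := H 1%N (fun _ => Num.min x y) (fun _ => Num.max x y); rewrite !big_ord1.
case: (leP x y) => h /=.
  rewrite [X in _ -> X < e]distrC; apply.
  - by move=> i; split.
  - by move=> i j; rewrite !ord1 eqxx.
  - by move: xy; rewrite distrC ger0_norm ?subr_ge0.
apply.
- by move=> i; split => //; exact: ltW.
- by move=> i j; rewrite !ord1 eqxx.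
- by move: xy; rewrite ger0_norm ?subr_ge0 // ltW.
Qed.

Lemma within_continuous_bounded a b f : a <= b ->
  {within `[a, b], continuous f} ->
  exists2 M : R, 0 <= M & forall x, x \in `[a, b] -> `|f x| <= M.
Proof.
move=> ab cf; have [c _ Hc] := EVT_max ab cf; have [d _ Hd] := EVT_min ab cf.
exists (`|f c| + `|f d|) => [|x xab]; first exact: addr_ge0.
rewrite ler_norml; have := Hc _ xab; have := Hd _ xab.
have := ler_norm (f c); have := ler_norm (- f d); rewrite normrN.
have := normr_ge0 (f d); have := normr_ge0 (f c).
by move=> *; apply/andP; split; lra.
Qed.

Lemma C1_lipschitz_segment (k k' : R -> R) (M : R) :
  (forall y : R, is_derive y 1 k (k' y)) -> continuous k' ->
  exists2 L : R, 0 <= L & forall x y, `|x| <= M -> `|y| <= M ->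
    `|k x - k y| <= L * `|x - y|.
Proof.
move=> dk ck'; have [M0|M0] := leP 0 M; last first.
  by exists 0 => // x y /(le_trans (normr_ge0 x)); rewrite leNgt M0.
have [||L L0 HL] := @within_continuous_bounded (- M) M k'; first lra.
  exact: continuous_subspaceT.
exists L => // x y.
wlog xy : x y / y <= x => [W|xM yM].
  by case: (leP y x) => [/W//|/ltW /W H xM yM]; rewrite distrC [`|x - y|]distrC; apply: H.
have [|c cxy ->] := @MVT_segment R k k' y x xy (fun z _ => dk z).
  by apply: derivable_within_continuous => z _; have [] := dk z.
rewrite normrM ler_wpM2r //; apply: HL.
move: cxy xM yM; rewrite !in_itv /= !ler_norml.
by move=> /andP[? ?] /andP[? ?] /andP[? ?]; apply/andP; split; lra.
Qed.

Lemma ac_derive_within a b f g : ac_derive a b f g -> {within `[a, b], continuous f}.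
Proof. by move=> [/abs_continuous_continuous]. Qed.

Lemma ac_derive_sub a b c d f g : a <= c -> d <= b ->
  ac_derive a b f g -> ac_derive c d f g.
Proof.
move=> ac db [acf df]; split; first exact: abs_continuous_sub acf.
apply: ae_imply df => x H; rewrite in_itv /= => /andP[cx xd]; apply: H.
by rewrite in_itv /=; apply/andP; split; lra.
Qed.

Lemma ac_derive_cst a b (c : R) : ac_derive a b (fun=> c) (fun=> 0).
Proof.
split; last by apply: aeW => x _; exact: is_derive_cst.
move=> e e0; exists 1 => // n l r _ _ _.
by rewrite big1 // => i _; rewrite subrr normr0.
Qed.

Lemma ac_derive_id a b : ac_derive a b id (fun=> 1).
Proof.
split; last by apply: aeW => x _; exact: is_derive_id.
move=> e e0; exists e => // n l r lr _; apply: le_lt_trans.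
by apply: ler_sum => i _; have [_ h _] := lr i; rewrite ger0_norm ?subr_ge0.
Qed.

Lemma ac_derive_comp a b f g (k k' : R -> R) : a <= b ->
  (forall y : R, is_derive y 1 k (k' y)) -> continuous k' ->
  ac_derive a b f g -> ac_derive a b (fun x => k (f x)) (fun x => k' (f x) * g x).
Proof.
move=> ab dk ck' [acf df]; split.
  have [M M0 HM] := within_continuous_bounded ab (abs_continuous_continuous acf).
  have [L L0 HL] := C1_lipschitz_segment M dk ck'.
  apply: (@abs_continuous_dom2 _ _ f f _ L) => // x y xab yab.
  apply: (le_trans (HL _ _ (HM _ xab) (HM _ yab))).
  by rewrite ler_wpM2l // lerDl.
by apply: ae_imply df => x H /H ?; apply: is_derive1_comp.
Qed.

Lemma ac_deriveD a b f g (f1 g1 : R -> R) : ac_derive a b f g -> ac_derive a b f1 g1 ->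
  ac_derive a b (fun x => f x + f1 x) (fun x => g x + g1 x).
Proof.
move=> [acf df] [acf1 df1]; split; last first.
  apply: ae_imply (ae_andP df df1) => x [H H1] xab.
  by have := H xab; have := H1 xab => ? ?; exact: is_deriveD.
apply: (abs_continuous_dom2 (L := 1) acf acf1) => x y _ _.
by rewrite mul1r opprD addrACA; exact: ler_normD.
Qed.

Lemma ac_deriveM a b f g (f1 g1 : R -> R) : a <= b ->
  ac_derive a b f g -> ac_derive a b f1 g1 ->
  ac_derive a b (fun x => f x * f1 x) (fun x => g x * f1 x + f x * g1 x).
Proof.
move=> ab [acf df] [acf1 df1]; split; last first.
  apply: ae_imply (ae_andP df df1) => x [H H1] xab.
  have := H xab; have := H1 xab => ? ?; apply: is_derive_eq (is_deriveM _ _) _.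
  by rewrite /GRing.scale /= addrC mulrC.
have [M M0 HM] := within_continuous_bounded ab (abs_continuous_continuous acf).
have [N N0 HN] := within_continuous_bounded ab (abs_continuous_continuous acf1).
apply: (abs_continuous_dom2 (L := M + N) acf acf1) => x y xab yab.
have -> : f x * f1 x - f y * f1 y = f x * (f1 x - f1 y) + (f x - f y) * f1 y by ring.
apply: (le_trans (ler_normD _ _)); rewrite !normrM.
have h1 : `|f x| * `|f1 x - f1 y| <= (M + N) * `|f1 x - f1 y|.
  by rewrite ler_wpM2r // (le_trans (HM _ xab)) // lerDl.
have h2 : `|f x - f y| * `|f1 y| <= (M + N) * `|f x - f y|.
  by rewrite mulrC ler_wpM2r // (le_trans (HN _ yab)) // lerDr.
by lra.
Qed.

Lemma ac_deriveZ a b f g (c : R) : a <= b -> ac_derive a b f g ->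
  ac_derive a b (fun x => c * f x) (fun x => c * g x).
Proof.
move=> ab fg; have := ac_deriveM ab (ac_derive_cst a b c) fg.
by congr (ac_derive _ _ _ _); apply/funext => x; rewrite mul0r add0r.
Qed.

Lemma ac_derive_ext a b f g (g1 : R -> R) :
  ac_derive a b f g -> {in `]a, b[, g =1 g1} -> ac_derive a b f g1.
Proof.
move=> [acf df] gg1; split => //; apply: ae_imply df => x H xab.
by rewrite -gg1 //; exact: H.
Qed.

Lemma EFin_Rintegral (D : set R) g : measurable D ->
  mu.-integrable D (EFin \o g) ->
  (\int[mu]_(x in D) g x)%:E = (\int[mu]_(x in D) (g x)%:E)%E.
Proof. by move=> mD ig; rewrite /Rintegral fineK // integrable_fin_num. Qed.

Lemma ae_derive_integral a b g : mu.-integrable `[a, b] (EFin \o g) ->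
  {ae mu, forall x, x \in `]a, b[ ->
     is_derive x 1 (fun x => \int[mu]_(t in `[a, x]) g t) (g x)}.
Proof.
(* Lebesgue differentiation asks for integrability on every segment from a to y, which extension by
   zero provides; near an interior point the primitive is unchanged. *)
move=> intg; pose g0 := g \_ `[a, b].
have mI : measurable (`[a, b]%classic : set R) by exact: measurable_itv.
have intg0 : mu.-integrable setT (EFin \o g0).
  by rewrite -restrict_EFin; apply/integrable_restrict => //=; rewrite setTI.
have h : forall y, mu.-integrable [set` Interval (BLeft a) (BRight y)] (EFin \o g0).
  by move=> y; apply: integrableS intg0.
apply: ae_imply (FTC1 h (integrable_locally mI intg)) => x H.
rewrite in_itv /= => /andP[ax xb].
have [|dF F'] := H; first by rewrite /= lte_fin.
have -> : g x = 'D_1 (fun x => \int[mu]_(t in `[a, x]) g0 t) x.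
  rewrite -derive1E F' /g0 patchE mem_set //=.
  by rewrite in_itv /= (ltW ax) (ltW xb).
apply: near_eq_is_derive (derivableP dF).
near=> y; apply: eq_Rintegral => t; rewrite inE /= in_itv /= => /andP[at_ ty].
rewrite /g0 patchE mem_set //= in_itv /= at_ (le_trans ty) //.
by apply: ltW; near: y; apply: lt_nbhsl.
Unshelve. all: by end_near. Qed.

Lemma abs_continuous_integral a b g : mu.-integrable `[a, b] (EFin \o g) ->
  abs_continuous a b (fun x => \int[mu]_(t in `[a, x]) g t).
Proof.
move=> intg e e0; pose g0 := g \_ `[a, b].
have mI : measurable (`[a, b]%classic : set R) by exact: measurable_itv.
have intg0 : mu.-integrable setT (EFin \o g0).
  by rewrite -restrict_EFin; apply/integrable_restrict => //=; rewrite setTI.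
have [d [d0 Hd]] := integral_normr_continuous intg0 e0.
exists d => // n l r lr no lrd.
have mU : measurable (\big[setU/set0]_(i < n) `]l i, r i]%classic : set R).
  by apply: bigsetU_measurable => i _; exact: measurable_itv.
have lr' i : l i <= r i by have [] := lr i.
have := Hd _ mU; rewrite [X in (X < _)%E](measure_nonoverlapping lr' no) lte_fin.
move=> /(_ lrd).
apply: le_lt_trans.
have inU i : mu.-integrable `]l i, r i] (EFin \o g0) by apply: integrableS intg0.
have inA i : mu.-integrable `]l i, r i] (EFin \o (fun x => `|g0 x|)).
  by apply: integrable_norm (inU i).
apply: (@le_trans _ _ (\sum_(i < n) \int[mu]_(t in `]l i, r i]) `|g0 t|)).
  apply: ler_sum => i _; have [al lri rb] := lr i.
  rewrite Rintegral_itvB ?bnd_simp //; last first.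
    by apply: integrableS intg => //; apply: subset_itvl; rewrite bnd_simp.
  have -> : \int[mu]_(t in `]l i, r i]) g t = \int[mu]_(t in `]l i, r i]) g0 t.
    apply: eq_Rintegral => t; rewrite inE /= in_itv /= => /andP[lt tr].
    by rewrite /g0 patchE mem_set //= in_itv /=; apply/andP; split; lra.
  by apply: le_normr_Rintegral => //; exact: inU.
rewrite -lee_fin -sumEFin EFin_Rintegral //; last first.
  by apply: integrable_norm; exact: integrableS intg0.
rewrite ge0_integral_bigsetU ?index_enum_uniq //.
- by apply: lee_sum => i _; rewrite EFin_Rintegral //; exact: inA.
- by apply: sub_trivIset (trivIset_nonoverlapping no).
- apply/measurable_EFinP; apply: measurable_funTS.
  apply: measurableT_comp => //; apply/measurable_EFinP.
  exact: measurable_int intg0.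
Qed.

Lemma ac_derive_integral a b g : mu.-integrable `[a, b] (EFin \o g) ->
  ac_derive a b (fun x => \int[mu]_(t in `[a, x]) g t) g.
Proof.
by move=> ig; split; [exact: abs_continuous_integral|exact: ae_derive_integral].
Qed.

(** The difference of f and the indefinite integral of g has derivative 0 almost everywhere, so it
    and its opposite are both nondecreasing. *)
Lemma ac_derive_FTC a b f g : a <= b -> ac_derive a b f g ->
  mu.-integrable `[a, b] (EFin \o g) -> \int[mu]_(t in `[a, b]) g t = f b - f a.
Proof.
move=> ab fg ig; have GG := ac_derive_integral ig.
have := ac_deriveD fg (ac_deriveZ (-1) ab GG).
have := ac_deriveD GG (ac_deriveZ (-1) ab fg).
move=> /(ac_derive_le ab) h1 /(ac_derive_le ab) h2.
have zero : {ae mu, forall x, x \in `]a, b[ -> 0 <= g x + -1 * g x}.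
  by apply: aeW => x _; lra.
have := h1 zero; have := h2 zero.
rewrite !set_itv1 !Rintegral_set1; lra.
Qed.

(** K is a primitive of k, and v exp(K) has derivative (v' + k v) exp(K). Upper bounds come from the
    same statement applied to -v. *)
Lemma ac_derive_gronwall a b (v dv K k : R -> R) : a <= b ->
  ac_derive a b v dv -> ac_derive a b K k ->
  {ae mu, forall x, x \in `]a, b[ -> 0 <= dv x + k x * v x} ->
  v a * expR (K a) <= v b * expR (K b).
Proof.
move=> ab vdv Kk H.
have cexp : continuous (@expR R) by move=> x; exact: continuous_expR.
have := ac_derive_comp ab (@is_derive_expR R) cexp Kk.
move=> /(ac_deriveM ab vdv) /(ac_derive_le ab); apply.
apply: ae_imply H => x H xab.
have -> : dv x * expR (K x) + v x * (expR (K x) * k x)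
  = (dv x + k x * v x) * expR (K x) by ring.
by rewrite mulr_ge0 ?expR_ge0 // H.
Qed.

Lemma measurable_fun_within_continuous a b f : {within `[a, b], continuous f} ->
  measurable_fun `[a, b] f.
Proof. by apply: subspace_continuous_measurable_fun; exact: measurable_itv. Qed.

Lemma integrable_within_continuousM a b f g : a <= b ->
  {within `[a, b], continuous f} -> mu.-integrable `[a, b] (EFin \o g) ->
  mu.-integrable `[a, b] (EFin \o (fun x => f x * g x)).
Proof.
move=> ab cf ig; have mI : measurable (`[a, b]%classic : set R) by exact: measurable_itv.
have [M M0 HM] := within_continuous_bounded ab cf.
apply: (le_integrable _ _ _ (integrableZl _ M ig)) => //.
  apply/measurable_EFinP/measurable_funM; first exact: measurable_fun_within_continuous.
  by apply/measurable_EFinP; exact: measurable_int ig.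
move=> x xab /=; rewrite lee_fin !normrM ler_wpM2r // (le_trans (HM _ xab)) //.
exact: ler_norm.
Qed.

Lemma integrable_within_continuous a b f : {within `[a, b], continuous f} ->
  mu.-integrable `[a, b] (EFin \o f).
Proof. by apply: continuous_compact_integrable; exact: segment_compact. Qed.

Lemma integrable_of_sqr a b g : measurable_fun `[a, b] g ->
  mu.-integrable `[a, b] (EFin \o (fun x => g x ^+ 2)) ->
  mu.-integrable `[a, b] (EFin \o g).
Proof.
move=> mg ig; have mI : measurable (`[a, b]%classic : set R) by exact: measurable_itv.
have i1 : mu.-integrable `[a, b] (EFin \o cst (1 : R)).
  by apply: integrable_within_continuous; apply: continuous_subspaceT => ?; exact: cvg_cst.
apply: (le_integrable _ _ _ (integrableD _ i1 ig)) => //.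
  exact/measurable_EFinP.
move=> x xab /=; rewrite lee_fin [leRHS]ger0_norm; last first.
  by rewrite addr_ge0 ?ler01 // exprn_even_ge0.
have := sqr_ge0 (`|g x| - 1); rewrite sqrrB expr1n real_normK ?num_real //.
by have := normr_ge0 (g x); rewrite mulr1; lra.
Qed.

End AbsolutelyContinuous.

(** * Derivatives relative to a segment *)

Section DerivativeIn.
Context {R : realType}.
Implicit Types (f : R -> R) (a b x d : R).

Lemma derivative_in_slope a b f x d e : derivative_in `[a, b]%classic f x d -> 0 < e ->
  exists2 dl : R, 0 < dl & forall z, z \in `[a, b] -> `|z - x| < dl ->
    `|f z - f x - d * (z - x)| <= e * `|z - x|.
Proof.
move=> /cvgrPdist_le H /H [dl /= dl0 {}H]; exists dl => // z zab zx.
have [->|zx0] := eqVneq z x; first by rewrite !subrr mulr0 subrr normr0 mulr0.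
have zx1 : z - x != 0 by rewrite subr_eq0.
have := H z; rewrite /= distrC => /(_ zx zx0 zab).
rewrite distrC -(ler_pM2r (x := `|z - x|)) ?normr_gt0 // -normrM mulrBl divfK //.
Qed.

Lemma derivative_in_is_derive a b f x d : x \in `]a, b[ ->
  derivative_in `[a, b]%classic f x d -> is_derive x 1 f d.
Proof.
rewrite in_itv /= => /andP[ax xb] df.
suff H : h^-1 *: ((f \o shift x) (h *: 1) - f x) @[h --> (0 : R)^'] --> d.
  by apply: DeriveDef; [apply/cvg_ex; exists d|exact/cvg_lim].
apply/cvgrPdist_le => e e0.
have [dl dl0 {}df] := derivative_in_slope df e0.
near=> h; have h0 : h != 0 by near: h; exact: nbhs_dnbhs_neq.
rewrite distrC /shift /= /GRing.scale /= mulr1.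
have hx : h + x - x = h by ring.
have := df (h + x); rewrite hx in_itv /=.
have /andP[h1 h2] : - (x - a) < h < b - x.
  have : `|h| < Num.min (x - a) (b - x).
    by near: h; apply: dnbhs0_lt; rewrite lt_min !subr_gt0 ax.
  rewrite lt_min !ltr_norml => /andP[/andP[? ?] /andP[? ?]].
  by apply/andP; split.
have -> : (a <= h + x <= b) by apply/andP; split; lra.
have -> : `|h| < dl by near: h; exact: dnbhs0_lt.
move=> /(_ isT isT) H.
rewrite -(ler_pM2r (x := `|h|)) ?normr_gt0 // -normrM mulrBl mulrAC mulVf // mul1r.
exact: H.
Unshelve. all: by end_near. Qed.

Lemma derivative_in_within_continuous a b f df :
  (forall x, x \in `[a, b] -> derivative_in `[a, b]%classic f x (df x)) ->
  {within `[a, b], continuous f}.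
Proof.
move=> H; apply/subspace_continuousP => x /= xab.
have [dl dl0 {}H] := derivative_in_slope (H _ xab) ltr01.
apply/cvgrPdist_le => e e0.
have c0 : 0 < `|df x| + 1 by rewrite ltr_wpDl.
exists (Num.min dl (e / (`|df x| + 1))); first by rewrite /= lt_min dl0 divr_gt0.
move=> y /=; rewrite distrC lt_min => /andP[yx1 yx2] yab.
rewrite distrC; have := H _ yab yx1; rewrite mul1r => h1.
have h2 : `|f y - f x| <= `|df x| * `|y - x| + `|y - x|.
  by rewrite -normrM; have := ler_normD (df x * (y - x)) (f y - f x - df x * (y - x));
    rewrite addrC subrK; lra.
apply: (le_trans h2); move: yx2; rewrite ltr_pdivlMr //; lra.
Qed.

(** The continuous derivative is bounded on the segment, so f is Lipschitz by the mean value
    theorem. *)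
Lemma ac_derive_of_derivative_in a b f df : a <= b ->
  {within `[a, b], continuous df} ->
  (forall x, x \in `[a, b] -> derivative_in `[a, b]%classic f x (df x)) ->
  ac_derive a b f df.
Proof.
move=> ab cdf H; split; last first.
  apply: aeW => x xab; apply: derivative_in_is_derive (xab) (H _ _).
  exact: subset_itv_oo_cc.
have [M M0 HM] := within_continuous_bounded ab cdf.
have cf := derivative_in_within_continuous H.
have [aid _] := ac_derive_id a b.
apply: (abs_continuous_dom2 (L := M) aid aid) => x y.
wlog yx : x y / y <= x => [W|xab yab].
  case: (leP y x) => [/W//|/ltW /W {}W xab yab].
  by rewrite distrC [`|id x - _|]distrC; exact: W.
move: (xab) (yab); rewrite !in_itv /= => /andP[? ?] /andP[? ?].
have [||c cyx ->] := @MVT_segment R f df y x yx.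
- move=> z; rewrite in_itv /= => /andP[? ?].
  have zab : z \in `]a, b[ by rewrite in_itv /=; apply/andP; split; lra.
  by apply: derivative_in_is_derive (zab) (H _ _); exact: subset_itv_oo_cc.
- apply: continuous_subspaceW cf => z /=; rewrite !in_itv /= => /andP[? ?].
  by apply/andP; split; lra.
rewrite normrM; apply: ler_pM => //; last by rewrite lerDl.
apply: HM; move: cyx; rewrite !in_itv /= => /andP[? ?].
by apply/andP; split; lra.
Qed.

End DerivativeIn.

Section WithinContinuous.
Context {R : realType} (A : set R).
Implicit Types f g : R -> R.

Lemma within_continuousM f g : {within A, continuous f} -> {within A, continuous g} ->
  {within A, continuous (fun x => f x * g x)}.
Proof. by move=> cf cg x; apply: cvgM; [exact: cf|exact: cg]. Qed.

Lemma within_continuousV f : (forall x, A x -> f x != 0) ->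
  {within A, continuous f} -> {within A, continuous (fun x => (f x)^-1)}.
Proof.
move=> f0 /subspace_continuousP cf; apply/subspace_continuousP => x Ax.
by apply: cvgV; [exact: f0|exact: cf].
Qed.

Lemma within_continuous_cst (c : R) : {within A, continuous (fun=> c)}.
Proof. by apply: continuous_subspaceT => ?; exact: cvg_cst. Qed.

Lemma within_continuous_scale f (t : R) : continuous f ->
  {within A, continuous (fun x => f (t * x))}.
Proof.
move=> cf; apply: continuous_subspaceT => x.
apply: (@continuous_comp _ _ _ (fun x => t * x) f); last exact: cf.
by apply: cvgM; [exact: cvg_cst|exact: cvg_id].
Qed.

Lemma within_continuousT_comp f g : continuous g -> {within A, continuous f} ->
  {within A, continuous (fun x => g (f x))}.
Proof. by move=> cg cf x; apply: (continuous_comp (cf x)); exact: cg. Qed.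

End WithinContinuous.

(** * The Prüfer angle *)

Lemma sin_atan {R : realType} (t : R) : sin (atan t) = t * cos (atan t).
Proof.
have c0 : cos (atan t) != 0.
  by rewrite gt_eqF // cos_gt0_pihalf // atan_gtNpi2 atan_ltpi2.
by rewrite -{2}(atanK t) /tan divfK.
Qed.

Lemma cos_atan_gt0 {R : realType} (t : R) : 0 < cos (atan t).
Proof. by rewrite cos_gt0_pihalf // atan_gtNpi2 atan_ltpi2. Qed.

Lemma L2_0pi_measurable {R : realType} (q : R -> R) : L2_0pi q ->
  measurable_fun `[0, pi] q.
Proof.
by move=> [mq _]; apply/measurable_fun_itv_bndo_bndcP/measurable_fun_itv_obnd_cbndP.
Qed.

Lemma L2_0pi_integrable_sqr {R : realType} (q : R -> R) : L2_0pi q ->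
  (@lebesgue_measure R).-integrable `[0, pi] (EFin \o (fun x => q x ^+ 2)).
Proof.
move=> qL2; have mq := L2_0pi_measurable qL2; case: qL2 => _ /integrableP[_ iq].
have mq2 : measurable_fun `[0, pi] (EFin \o (fun x => q x ^+ 2)).
  by apply/measurable_EFinP; exact: measurable_funX.
apply/integrableP; split => //; move: iq.
have mo : measurable_fun `]0, pi] (fun x => `|(q x ^+ 2)%:E|%E).
  apply: measurableT_comp => //; apply: measurable_funS mq2 => //.
  exact: subset_itv_oc_cc.
have moo : measurable_fun `]0, pi[ (fun x => `|(q x ^+ 2)%:E|%E).
  by apply: measurable_funS mo => //; exact: subset_itv_oo_oc.
by rewrite integral_itv_bndo_bndc // integral_itv_obnd_cbnd.
Qed.

(** * Energy bounds for solutions and construction of the angle *)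

Section SturmLiouville.
Context {R : realType} (q : R -> R).
Hypothesis qL2 : L2_0pi q.
Local Notation mu := (@lebesgue_measure R).
Local Notation cont f := {within `[0, pi], continuous f}.
Implicit Types (lam : R) (y dy A B C f : R -> R).

Lemma L2_0pi_integrable : mu.-integrable `[0, pi] (EFin \o q).
Proof.
exact: integrable_of_sqr (L2_0pi_measurable qL2) (L2_0pi_integrable_sqr qL2).
Qed.

Lemma integrable_quadratic A B C : cont A -> cont B -> cont C ->
  mu.-integrable `[0, pi] (EFin \o (fun x => A x * q x ^+ 2 + B x * q x + C x)).
Proof.
move=> cA cB cC; have mI : measurable (`[0, pi]%classic : set R) by exact: measurable_itv.
have iA := integrable_within_continuousM (pi_ge0 R) cA (L2_0pi_integrable_sqr qL2).
have iB := integrable_within_continuousM (pi_ge0 R) cB L2_0pi_integrable.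
exact: integrableD (integrableD _ iA iB) (integrable_within_continuous cC).
Qed.

Lemma integrable_affine A B : cont A -> cont B ->
  mu.-integrable `[0, pi] (EFin \o (fun x => A x * q x + B x)).
Proof.
move=> cA cB; have := integrable_quadratic (@within_continuous_cst R _ 0) cA cB.
by apply: eq_integrable => // x _ /=; rewrite mul0r add0r.
Qed.

Lemma integrable_norm_potential : mu.-integrable `[0, pi] (EFin \o (fun x => `|q x|)).
Proof. exact: integrable_norm L2_0pi_integrable. Qed.

(** The primitive that enters all Gronwall exponents; its value at pi bounds the integral of q
    against any function bounded by 1. *)
Definition normq_int (x : R) : R := \int[mu]_(t in `[0, x]) `|q t|.

Lemma ac_derive_normq_int : ac_derive 0 pi normq_int (fun x => `|q x|).
Proof. exact: ac_derive_integral integrable_norm_potential. Qed.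

Lemma normq_int0 : normq_int 0 = 0.
Proof. by rewrite /normq_int set_itv1 Rintegral_set1. Qed.

Lemma normq_int_le x : 0 <= x <= pi -> 0 <= normq_int x <= normq_int pi.
Proof.
move=> /andP[x0 xpi]; apply/andP; split; first exact: Rintegral_ge0.
apply: (ac_derive_le xpi (ac_derive_sub x0 (lexx _) ac_derive_normq_int)).
by apply: aeW => z _.
Qed.

(** The equation as a first-order system for (y, y'), in the form that can be integrated. *)
Definition ac_solution lam y dy : Prop :=
  ac_derive 0 pi y dy /\ ac_derive 0 pi dy (fun x => (q x - lam) * y x).

Lemma SL_solution_ac lam y dy : SL_solution q lam y dy -> ac_solution lam y dy.
Proof.
move=> [dY acdy ddY].
split; first exact: ac_derive_of_derivative_in (pi_ge0 R) (abs_continuous_continuous acdy) dY.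
split => //; apply: ae_imply ddY => x + xpi.
case=> [|ddy dE yE]; first exact: subset_itv_oo_cc.
have -> : (q x - lam) * y x = ddy by rewrite mulrBl -yE; ring.
exact: derivative_in_is_derive dE.
Qed.

Lemma ac_solution_sub lam y dy z dz (c : R) :
  ac_solution lam y dy -> ac_solution lam z dz ->
  ac_solution lam (fun x => y x - c * z x) (fun x => dy x - c * dz x).
Proof.
have ab := pi_ge0 R; move=> [y1 y2] [z1 z2]; split.
  have := ac_deriveD y1 (ac_deriveZ (- c) ab z1).
  by congr (ac_derive _ _ _ _); apply/funext => x; ring.
have := ac_deriveD y2 (ac_deriveZ (- c) ab z2).
by congr (ac_derive _ _ _ _); apply/funext => x; ring.
Qed.

Lemma ac_derive_sqr f df : ac_derive 0 pi f df ->
  ac_derive 0 pi (fun x => f x ^+ 2) (fun x => 2 * f x * df x).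
Proof.
move=> ff; have := ac_deriveM (pi_ge0 R) ff ff.
by congr (ac_derive _ _ _ _); apply/funext => x; ring.
Qed.

(** The derivative 2 (1 + q - lam) y y' of the energy is at most (|q| + |lam| + 1) times the energy,
    and Gronwall applies in both directions. The lower bound keeps (y, y') away from 0, so that an
    angle exists; the upper bound gives uniqueness. *)
Lemma ac_solution_energy lam y dy x : ac_solution lam y dy -> 0 <= x <= pi ->
  let K := normq_int x + (`|lam| + 1) * x in
  (y 0 ^+ 2 + dy 0 ^+ 2) <= (y x ^+ 2 + dy x ^+ 2) * expR K /\
  (y x ^+ 2 + dy x ^+ 2) <= (y 0 ^+ 2 + dy 0 ^+ 2) * expR K.
Proof.
move=> [y1 y2] /andP[x0 xpi] K; have ab := pi_ge0 R.
have vv := ac_deriveD (ac_derive_sqr y1) (ac_derive_sqr y2).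
have KK := ac_deriveD ac_derive_normq_int (ac_deriveZ (`|lam| + 1) ab (ac_derive_id 0 pi)).
have sub := ac_derive_sub (lexx 0) xpi.
have K0 : normq_int 0 + (`|lam| + 1) * id 0 = 0 by rewrite normq_int0 mulr0 addr0.
have key z : `|2 * y z * dy z + 2 * dy z * ((q z - lam) * y z)| <=
    (`|q z| + (`|lam| + 1) * 1) * (y z ^+ 2 + dy z ^+ 2).
  have -> : 2 * y z * dy z + 2 * dy z * ((q z - lam) * y z) =
    (1 + q z - lam) * (2 * y z * dy z) by ring.
  rewrite normrM ler_pM //.
    rewrite mulr1 (le_trans (ler_normB _ _)) // (le_trans (lerD (ler_normD _ _) (lexx _))) //.
    by rewrite normr1; lra.
  rewrite ler_norml; have := sqr_ge0 (y z + dy z); have := sqr_ge0 (y z - dy z).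
  by rewrite !sqrrD mulrN sqrrN => *; apply/andP; split; lra.
split.
  have := ac_derive_gronwall x0 (sub _ _ vv) (sub _ _ KK).
  rewrite K0 expR0 => H; lapply H; first by rewrite mulr1.
  by apply: aeW => z _; have := key z; rewrite ler_norml => /andP[+ _]; lra.
have := ac_derive_gronwall x0 (sub _ _ (ac_deriveZ (-1) ab vv)) (sub _ _ (ac_deriveZ (-1) ab KK)).
rewrite K0 mulr0 expR0 => H; lapply H; last first.
  by apply: aeW => z _; have := key z; rewrite ler_norml => /andP[_ +]; lra.
by rewrite mulr1 !mulN1r expRN mulNr lerN2 ler_pdivrMr ?expR_gt0.
Qed.

Lemma ac_solution_energy_gt0 lam y dy x : ac_solution lam y dy ->
  0 < y 0 ^+ 2 + dy 0 ^+ 2 -> 0 <= x <= pi -> 0 < y x ^+ 2 + dy x ^+ 2.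
Proof.
move=> s e0 x0; have [H _] := ac_solution_energy s x0.
by have := lt_le_trans e0 H; rewrite pmulr_lgt0 // expR_gt0.
Qed.

Lemma ac_solution_unique lam y dy x : ac_solution lam y dy ->
  y 0 = 0 -> dy 0 = 0 -> 0 <= x <= pi -> y x = 0 /\ dy x = 0.
Proof.
move=> s y0 dy0 x0; have [_] := ac_solution_energy s x0.
rewrite y0 dy0 expr0n /= addr0 mul0r => H.
have /eqP := le_anti (introT andP (conj H (addr_ge0 (sqr_ge0 (y x)) (sqr_ge0 (dy x))))).
by rewrite paddr_eq0 ?sqr_ge0 // !sqrf_eq0 => /andP[/eqP -> /eqP ->].
Qed.

(* The rotation z e^{-i th} of z = v + i u has real and imaginary parts solving the same
   scalar linear equation w' = c w, with c = (u u' + v v') / (u^2 + v^2), when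
   th' = Im(z'/z); so it keeps its direction. *)
Lemma angle_lift (u v du dv th dth K c : R -> R) :
  ac_derive 0 pi u du -> ac_derive 0 pi v dv -> ac_derive 0 pi th dth ->
  ac_derive 0 pi K c ->
  (forall x, 0 <= x <= pi -> 0 < u x ^+ 2 + v x ^+ 2) ->
  (forall x, dth x = (du x * v x - u x * dv x) / (u x ^+ 2 + v x ^+ 2)) ->
  (forall x, c x = - ((u x * du x + v x * dv x) / (u x ^+ 2 + v x ^+ 2))) ->
  K 0 = 0 ->
  u 0 * cos (th 0) = v 0 * sin (th 0) ->
  0 < u 0 * sin (th 0) + v 0 * cos (th 0) ->
  forall x, 0 <= x <= pi -> exists2 r : R, 0 < r &
    u x = r * sin (th x) /\ v x = r * cos (th x).
Proof.
move=> uu vv tt KK pos dthE cE K0 P0 Q0 x /andP[x0 xpi].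
have S := ac_derive_comp (pi_ge0 R) (@is_derive_sin R) (@continuous_cos R) tt.
have cNs : continuous (fun x : R => - sin x).
  by move=> z; apply: cvgN; exact: continuous_sin.
have C := ac_derive_comp (pi_ge0 R) (@is_derive_cos R) cNs tt.
have M := ac_deriveM (pi_ge0 R).
have D := ac_deriveD; have N f df (a : R) := @ac_deriveZ R 0 pi f df a (pi_ge0 R).
(* [PP] and [QQ] treat the imaginary and the real part of (v + i u) exp(-i th). The first vanishes
   at 0, the second is positive there; both properties persist. *)
have PP := D _ _ _ _ _ _ _ (M _ _ _ _ uu C) (N _ _ (-1) (M _ _ _ _ vv S)).
have QQ := D _ _ _ _ _ _ _ (M _ _ _ _ uu S) (M _ _ _ _ vv C).
have sub := ac_derive_sub (lexx 0) xpi.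
have gron w dw : ac_derive 0 pi w dw ->
    (forall z, 0 <= z <= pi -> dw z + c z * w z = 0) -> w x * expR (K x) = w 0.
  move=> ww wE; apply/le_anti/andP; split; last first.
    have := ac_derive_gronwall x0 (sub _ _ ww) (sub _ _ KK).
    rewrite K0 expR0 mulr1; apply; apply: aeW => z.
    by rewrite in_itv /= => /andP[? ?]; rewrite wE // (ltW _) //=; lra.
  have := ac_derive_gronwall x0 (sub _ _ (N _ _ (-1) ww)) (sub _ _ KK).
  rewrite K0 expR0 mulr1 !mulN1r mulNr lerN2; apply; apply: aeW => z.
  rewrite in_itv /= => /andP[? ?]; have := wE z; lra.
have r0 z : 0 <= z <= pi -> u z ^+ 2 + v z ^+ 2 != 0.
  by move=> /pos /lt0r_neq0.
have {}PP : (u x * cos (th x) + -1 * (v x * sin (th x))) * expR (K x) =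
    u 0 * cos (th 0) + -1 * (v 0 * sin (th 0)).
  by apply: (gron _ _ PP) => z zpi; rewrite dthE cE; field; exact: r0.
have {}QQ : (u x * sin (th x) + v x * cos (th x)) * expR (K x) =
    u 0 * sin (th 0) + v 0 * cos (th 0).
  by apply: (gron _ _ QQ) => z zpi; rewrite dthE cE; field; exact: r0.
have PE : u x * cos (th x) + -1 * (v x * sin (th x)) = 0.
  by apply: (mulIf (lt0r_neq0 (expR_gt0 (K x)))); rewrite PP P0 mul0r mulN1r subrr.
have QE : 0 < u x * sin (th x) + v x * cos (th x).
  by rewrite -(pmulr_lgt0 _ (expR_gt0 (K x))) QQ.
exists (u x * sin (th x) + v x * cos (th x)) => //.
have E1 z : z = z * (cos (th x) ^+ 2 + sin (th x) ^+ 2) by rewrite cos2Dsin2 mulr1.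
split; rewrite [LHS]E1.
  transitivity ((u x * sin (th x) + v x * cos (th x)) * sin (th x) +
    (u x * cos (th x) + -1 * (v x * sin (th x))) * cos (th x)); first by ring.
  by rewrite PE mul0r addr0.
transitivity ((u x * sin (th x) + v x * cos (th x)) * cos (th x) -
  (u x * cos (th x) + -1 * (v x * sin (th x))) * sin (th x)); first by ring.
by rewrite PE mul0r subr0.
Qed.

(** The scale sg is 1 for the angle that counts eigenvalues and s for the asymptotic one. No
    nonlinear equation is solved: the angle is defined as an integral along the known solution y,
    and the autonomous form of its derivative is recovered afterwards from the polar
    representation. *)
Lemma prufer_angle (h lam sg : R) y dy : 0 < sg -> ac_solution lam y dy ->
  y 0 = 1 -> dy 0 = h ->
  exists th : R -> R, [/\ th 0 = pi / 2 - atan (h / sg),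
    ac_derive 0 pi th
      (fun x => sg * cos (th x) ^+ 2 + (lam - q x) / sg * sin (th x) ^+ 2) &
    forall x, 0 <= x <= pi -> exists2 r : R, 0 < r &
      sg * y x = r * sin (th x) /\ dy x = r * cos (th x)].
Proof.
move=> sg0 s y0 dy0.
have [yy dd] := s; have ab := pi_ge0 R.
have pos x : 0 <= x <= pi -> 0 < (sg * y x) ^+ 2 + dy x ^+ 2.
  move=> xpi; have e0 : 0 < y 0 ^+ 2 + dy 0 ^+ 2.
    by rewrite y0 expr1n ltr_pwDl // sqr_ge0.
  have := ac_solution_energy_gt0 s e0 xpi.
  rewrite lt0r paddr_eq0 ?sqr_ge0 // => /andP[+ _].
  rewrite lt0r paddr_eq0 ?sqr_ge0 // addr_ge0 ?sqr_ge0 // andbT.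
  by rewrite !sqrf_eq0 mulf_eq0 (gt_eqF sg0).
have cy := ac_derive_within yy; have cdy := ac_derive_within dd.
pose rho x := (sg * y x) ^+ 2 + dy x ^+ 2.
have cc (k : R) : cont (fun=> k) := @within_continuous_cst R _ k.
have cM := @within_continuousM R `[0, pi]%classic.
have cD f g : cont f -> cont g -> cont (fun x => f x + g x) :=
  @within_continuousD _ _ _ _ f g.
have csgy : cont (fun x => sg * y x) by exact: cM.
have cr : cont rho by apply: cD; apply: (within_continuousT_comp (@exprn_continuous R 2)).
have cV : cont (fun x => (rho x)^-1).
  by apply: within_continuousV => // x /= xpi; apply: lt0r_neq0; exact: pos.
(* With z = y' + i sg y, these are Im(z'/z) and -Re(z'/z), written as affine expressions in q with
   continuous coefficients so that they are integrable. *)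
pose dth x := (- (sg * y x * y x) * (rho x)^-1) * q x +
  (sg * dy x * dy x + lam * (sg * y x * y x)) * (rho x)^-1.
pose c x := (- (dy x * y x) * (rho x)^-1) * q x +
  (- (sg * y x * (sg * dy x)) + lam * (dy x * y x)) * (rho x)^-1.
have cN f : cont f -> cont (fun x => - f x).
  by move=> cf x; apply: cvgN; exact: cf.
have ith : mu.-integrable `[0, pi] (EFin \o dth).
  apply: integrable_affine; apply: (cM _ _ _ cV); first by apply: (cN); exact: (cM).
  by apply: (cD); do ?apply: (cM).
have ic : mu.-integrable `[0, pi] (EFin \o c).
  apply: integrable_affine; apply: (cM _ _ _ cV); first by apply: (cN); exact: (cM).
  by apply: (cD); [apply: (cN)|]; do ?apply: (cM).
pose th x := pi / 2 - atan (h / sg) + \int[mu]_(t in `[0, x]) dth t.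
have tt : ac_derive 0 pi th dth.
  have := ac_deriveD (ac_derive_cst 0 pi (pi / 2 - atan (h / sg))) (ac_derive_integral ith).
  by congr ac_derive; apply/funext => x; rewrite add0r.
have th0 : th 0 = pi / 2 - atan (h / sg).
  by rewrite /th set_itv1 Rintegral_set1 addr0.
have sE : sin (th 0) = cos (atan (h / sg)).
  by rewrite th0 -[in RHS]cosN -sinDpihalf addrC.
have cE : cos (th 0) = sin (atan (h / sg)).
  by rewrite th0 -[RHS]opprK -sinN -cosDpihalf addrC.
have lift : forall x, 0 <= x <= pi -> exists2 r : R, 0 < r &
      sg * y x = r * sin (th x) /\ dy x = r * cos (th x).
  apply: (angle_lift (ac_deriveZ sg ab yy) dd tt (ac_derive_integral ic)) => //.
  - by move=> x; rewrite /dth /rho; ring.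
  - by move=> x; rewrite /c /rho; ring.
  - by rewrite set_itv1 Rintegral_set1.
  - by rewrite y0 dy0 sE cE sin_atan; field; exact: lt0r_neq0.
  - rewrite y0 dy0 sE cE sin_atan.
    have -> : sg * 1 * cos (atan (h / sg)) + h * (h / sg * cos (atan (h / sg))) =
      (sg + h ^+ 2 / sg) * cos (atan (h / sg)) by field; exact: lt0r_neq0.
    by rewrite mulr_gt0 ?cos_atan_gt0 // ltr_pwDl // divr_ge0 ?sqr_ge0 // ltW.
exists th; split => //.
apply: (ac_derive_ext tt) => x; rewrite in_itv /= => /andP[/ltW x0 /ltW xpi].
have [|r r0 [yE dyE]] := lift x; first by rewrite x0.
have {}yE : y x = r * sin (th x) / sg by rewrite -yE [sg * _]mulrC mulfK // lt0r_neq0.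
have rE : rho x = r ^+ 2.
  rewrite /rho yE dyE; transitivity (r ^+ 2 * (cos (th x) ^+ 2 + sin (th x) ^+ 2)).
    by field; exact: lt0r_neq0.
  by rewrite cos2Dsin2 mulr1.
rewrite /dth rE yE dyE; field; rewrite !lt0r_neq0 //.
Qed.

End SturmLiouville.

(** * The Prüfer angle as a function of lambda *)

Section AngleComparison.
Context {R : realType}.
Local Notation mu := (@lebesgue_measure R).

Lemma lipschitz_of_derive (k k' : R -> R) (L : R) :
  (forall y : R, is_derive y 1 k (k' y)) -> (forall y, `|k' y| <= L) ->
  forall x y, `|k x - k y| <= L * `|x - y|.
Proof.
move=> dk HL x y.
wlog xy : x y / y <= x => [W|].
  by case: (leP y x) => [/W//|/ltW /W H]; rewrite distrC [`|x - y|]distrC; apply: H.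
have [|c cxy ->] := @MVT_segment R k k' y x xy (fun z _ => dk z).
  by apply: derivable_within_continuous => z _; have [] := dk z.
by rewrite normrM ler_wpM2r.
Qed.

Lemma sin_lipschitz (x y : R) : `|sin x - sin y| <= `|x - y|.
Proof. by rewrite -[leRHS]mul1r; apply: lipschitz_of_derive => // z; exact: cos_max. Qed.

Lemma cos_lipschitz (x y : R) : `|cos x - cos y| <= `|x - y|.
Proof.
rewrite -[leRHS]mul1r; apply: lipschitz_of_derive => z.
by rewrite normrN; exact: sin_max.
Qed.

Lemma sin2_lipschitz (x y : R) : `|sin x ^+ 2 - sin y ^+ 2| <= `|x - y|.
Proof.
have -> : sin x ^+ 2 - sin y ^+ 2 = (cos (y *+ 2) - cos (x *+ 2)) / 2.
  by rewrite !cos_mulr2n !cos2sin2; lra.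
rewrite normrM (ger0_norm (x := 2^-1)) ?invr_ge0 // ler_pdivrMr //.
apply: (le_trans (cos_lipschitz _ _)).
by rewrite -mulrnBl normrMn distrC mulr_natr.
Qed.

(** The square of the negative part is continuously differentiable, whereas the negative part itself
    is not; the chain rule for absolutely continuous functions then applies to it. *)
Lemma is_derive_min0_sqr (t : R) :
  is_derive t 1 (fun t : R => Num.min t 0 ^+ 2) (2 * Num.min t 0).
Proof.
have cmin : continuous (fun t : R => Num.min t 0).
  by move=> z; apply: continuous_min; [exact: cvg_id|exact: cvg_cst].
have [t0|t0|t0] := ltgtP t 0; rewrite ?t0.
- apply: (near_eq_is_derive (f := fun x : R => x ^+ 2)).
    by near=> z; rewrite min_l // ltW //; near: z; exact: lt_nbhsl.
  by apply: is_derive_eq; rewrite /GRing.scale /=; ring.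
- apply: (near_eq_is_derive (f := fun=> 0 : R)).
    by near=> z; rewrite min_r ?expr0n // ltW //; near: z; exact: lt_nbhsr.
  by apply: is_derive_eq; rewrite mulr0.
- apply/is_derive1_caratheodory; exists (fun z : R => Num.min z 0); split => //.
  - move=> z; rewrite minxx expr0n /= !subr0.
    by case: (leP z 0) => h; rewrite ?expr2 ?mul0r.
  - exact: cmin.
  - by rewrite minxx mulr0.
Unshelve. all: by end_near. Qed.

(** The function min(w, 0)^2 vanishes at a and its derivative is at most 2 k times itself, so
    Gronwall keeps it at 0. *)
Lemma compare_ge0 (a b x : R) (w dw K k : R -> R) :
  ac_derive a b w dw -> ac_derive a b K k -> 0 <= w a ->
  {ae mu, forall x, x \in `]a, b[ -> - (k x * `|w x|) <= dw x} ->
  a <= x <= b -> 0 <= w x.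
Proof.
move=> ww KK wa H /andP[ax xb].
have cmin : continuous (fun t : R => 2 * Num.min t 0).
  by move=> z; apply: cvgM; [exact: cvg_cst|apply: continuous_min; [exact: cvg_id|exact: cvg_cst]].
have sub := ac_derive_sub (lexx a) xb.
have vv := ac_derive_comp ax is_derive_min0_sqr cmin (sub _ _ ww).
have := ac_derive_gronwall ax (ac_deriveZ (-1) ax vv) (ac_deriveZ (-2) ax (sub _ _ KK)).
rewrite (min_r wa) expr0n /= mulr0 mul0r => G; lapply G => [|{G}].
  rewrite mulN1r mulNr oppr_ge0 pmulr_lle0 ?expR_gt0 // => h.
  have : Num.min (w x) 0 ^+ 2 = 0 by apply/le_anti; rewrite h sqr_ge0.
  by move=> /eqP; rewrite sqrf_eq0 => /eqP; case: (leP 0 (w x)) => // ? E; lra.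
apply: ae_imply H => z H; rewrite in_itv /= => /andP[az zx].
have {H} := H; rewrite in_itv /= az (lt_le_trans zx xb) => /(_ isT).
case: (leP 0 (w z)) => wz.
  by rewrite expr0n /= => _; lra.
rewrite (ltr0_norm wz) => h.
have -> : -1 * (2 * w z * dw z) + -2 * k z * (-1 * w z ^+ 2) =
  2 * - w z * (dw z - k z * w z) by ring.
by rewrite !mulr_ge0 //; lra.
Qed.

End AngleComparison.

(** * Comparison, monotonicity and continuity in the spectral parameter *)

Section AngleInLambda.
Context {R : realType} (q : R -> R).
Hypothesis qL2 : L2_0pi q.
Local Notation mu := (@lebesgue_measure R).
Implicit Types (lam : R) (th dth Th dTh : R -> R).

Definition angle_speed lam (t x : R) := cos t ^+ 2 + (lam - q x) * sin t ^+ 2.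

Lemma angle_speed_lipschitz lam (L s t x : R) : `|lam| <= L ->
  `|angle_speed lam s x - angle_speed lam t x| <= (`|q x| + (L + 1)) * `|s - t|.
Proof.
move=> lamL; rewrite /angle_speed !cos2sin2.
have -> : 1 - sin s ^+ 2 + (lam - q x) * sin s ^+ 2 -
    (1 - sin t ^+ 2 + (lam - q x) * sin t ^+ 2) =
  (lam - q x - 1) * (sin s ^+ 2 - sin t ^+ 2) by ring.
rewrite normrM ler_pM ?sin2_lipschitz //.
rewrite (le_trans (ler_normB _ _)) // (le_trans (lerD (ler_normB _ _) (lexx _))) //.
by rewrite normr1; lra.
Qed.

Lemma ac_derive_lipschitz_weight (L : R) :
  ac_derive 0 pi (fun x => normq_int q x + (L + 1) * x) (fun x => `|q x| + (L + 1)).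
Proof.
have := ac_deriveD (ac_derive_normq_int qL2) (ac_deriveZ (L + 1) (pi_ge0 R) (ac_derive_id 0 pi)).
by congr ac_derive; apply/funext => x; rewrite mulr1.
Qed.

(** A subsolution stays below a supersolution: the angle equation is Lipschitz in the angle with the
    weight |q| + |lam| + 1, which may be unbounded in x but is integrable. *)
Lemma angle_compare lam th dth Th dTh x :
  ac_derive 0 pi th dth -> ac_derive 0 pi Th dTh -> th 0 <= Th 0 ->
  {ae mu, forall x, x \in `]0, pi[ -> dth x <= angle_speed lam (th x) x} ->
  {ae mu, forall x, x \in `]0, pi[ -> angle_speed lam (Th x) x <= dTh x} ->
  0 <= x <= pi -> th x <= Th x.
Proof.
move=> tt TT t0 h1 h2 xpi; rewrite -subr_ge0.
have ww := ac_deriveD TT (ac_deriveZ (-1) (pi_ge0 R) tt).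
suff: 0 <= Th x + -1 * th x by rewrite mulN1r.
apply: (compare_ge0 ww (ac_derive_lipschitz_weight `|lam|) _ _ xpi).
  by rewrite mulN1r subr_ge0.
apply: ae_imply (ae_andP h1 h2) => z [{}h1 {}h2] zpi.
have := h1 zpi; have := h2 zpi.
have := angle_speed_lipschitz (Th z) (th z) z (lexx `|lam|).
by rewrite !mulN1r ler_norml => /andP[+ _]; lra.
Qed.

Definition is_angle lam th := ac_derive 0 pi th (fun x => angle_speed lam (th x) x).

Lemma is_angle_le lam lam' th th' x : lam <= lam' -> is_angle lam th -> is_angle lam' th' ->
  th 0 = th' 0 -> 0 <= x <= pi -> th x <= th' x.
Proof.
move=> ll tt tt' t0; apply: (angle_compare tt tt'); rewrite ?t0 //.
  by apply: aeW => z.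
apply: aeW => z _; rewrite /angle_speed lerD2l ler_wpM2r ?sqr_ge0 //; lra.
Qed.

(** The constant 0 is a subsolution for every lam, since the speed at angle 0 is 1. *)
Lemma is_angle_ge0 lam th x : is_angle lam th -> 0 <= th 0 -> 0 <= x <= pi -> 0 <= th x.
Proof.
move=> tt t0; apply: (angle_compare (ac_derive_cst 0 pi 0) tt) => //.
  by apply: aeW => z _; rewrite /angle_speed cos0 sin0 expr1n expr0n /= mulr0 addr0 ler01.
by apply: aeW => z.
Qed.

(** Multiplied by exp(-K), where K' is the Lipschitz weight, the difference of the angles grows at
    rate at most lam' - lam. The bound L makes the constant locally uniform in lam, which yields
    continuity. *)
Lemma is_angle_lipschitz (L lam lam' : R) th th' : `|lam| <= L -> lam <= lam' ->
  is_angle lam th -> is_angle lam' th' -> th 0 = th' 0 ->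
  th' pi - th pi <= (lam' - lam) * (pi * expR (normq_int q pi + (L + 1) * pi)).
Proof.
move=> lamL ll tt tt' t0.
have ab := pi_ge0 R; have L0 : 0 <= L := le_trans (normr_ge0 _) lamL.
have Kw := ac_derive_lipschitz_weight L.
have cexp : continuous (@expR R) by move=> x; exact: continuous_expR.
have ee := ac_derive_comp ab (@is_derive_expR R) cexp (ac_deriveZ (-1) ab Kw).
have ww := ac_deriveM ab (ac_deriveD tt' (ac_deriveZ (-1) ab tt)) ee.
have := ac_deriveD (ac_deriveZ (lam' - lam) ab (ac_derive_id 0 pi)) (ac_deriveZ (-1) ab ww).
move=> /(ac_derive_le ab) H; lapply H => [|{H}].
  rewrite t0 /= [expR (-1 * (_ + _ * pi))](_ : _ = (expR (normq_int q pi + (L + 1) * pi))^-1).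
    set e := expR (_ + _) => h.
    rewrite mulrA -ler_pdivrMr ?expR_gt0 //; lra.
  by rewrite mulN1r expRN.
apply: aeW => x; rewrite in_itv /= => /andP[/ltW x0 /ltW xpi].
have wx : th x <= th' x by apply: is_angle_le ll tt tt' t0 _; rewrite x0.
set E := expR _; have E0 : 0 <= E by exact: expR_ge0.
have E1 : E <= 1.
  rewrite /E -[leRHS]expR0 ler_expR mulN1r oppr_le0.
  have /(normq_int_le qL2)/andP[n0 _] : 0 <= x <= pi by rewrite x0.
  by rewrite addr_ge0 // mulr_ge0 //; lra.
have := angle_speed_lipschitz (th' x) (th x) x lamL.
rewrite (ger0_norm (x := th' x - th x)) ?subr_ge0 // ler_norml => /andP[_ h].
have h2 : angle_speed lam' (th' x) x = angle_speed lam (th' x) x + (lam' - lam) * sin (th' x) ^+ 2.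
  by rewrite /angle_speed; ring.
have s1 : sin (th' x) ^+ 2 <= 1 by rewrite sin2cos2 gerBl sqr_ge0.
have h3 : (lam' - lam) * sin (th' x) ^+ 2 <= lam' - lam by rewrite ler_piMr // subr_ge0.
pose w := angle_speed lam' (th' x) x - angle_speed lam (th x) x -
  (`|q x| + (L + 1)) * (th' x - th x).
have -> : (lam' - lam) * 1 + -1 *
    ((angle_speed lam' (th' x) x + -1 * angle_speed lam (th x) x) * E +
      (th' x + -1 * th x) * (E * (-1 * (`|q x| + (L + 1))))) =
   (lam' - lam) * (1 - E) + (lam' - lam - w) * E by rewrite /w; ring.
rewrite addr_ge0 // mulr_ge0 ?subr_ge0 //.
by rewrite /w h2; lra.
Qed.

(* A supersolution: cot Th = p, where p' + p^2 <= q - lam. *)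
Lemma is_angle_small (h B : R) : exists L : R, forall lam th, lam <= L ->
  is_angle lam th -> th 0 = pi / 2 - atan h -> th pi <= pi / 2 - atan B.
Proof.
have ab := pi_ge0 R.
have iq := ac_derive_integral (L2_0pi_integrable qL2).
set Q := (X in ac_derive _ _ X _) in iq.
have Q0 : Q 0 = 0 by rewrite /Q set_itv1 Rintegral_set1.
(* With p' = c + q this c gives p(0) = h and p(pi) = B, and the inequality for p reduces to lam <=
   -(c + p^2); M bounds |p|. *)
pose c := (B - h - Q pi) / pi.
pose p x := h + c * x + Q x.
have pp : ac_derive 0 pi p (fun x => c + q x).
  have := ac_deriveD (ac_deriveD (ac_derive_cst 0 pi h) (ac_deriveZ c ab (ac_derive_id 0 pi))) iq.
  by congr ac_derive; apply/funext => x; rewrite add0r mulr1.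
have [M M0 HM] := within_continuous_bounded ab (ac_derive_within pp).
exists (- (c + M ^+ 2)) => lam th lamL tt t0.
have cV : continuous (fun t : R => (1 + t ^+ 2)^-1).
  move=> t; apply: cvgV; first by rewrite gt_eqF // ltr_pwDl // sqr_ge0.
  by apply: cvgD; [exact: cvg_cst|exact: exprn_continuous].
have aa := ac_derive_comp ab (@is_derive1_atan R) cV pp.
have TT := ac_deriveD (ac_derive_cst 0 pi (pi / 2)) (ac_deriveZ (-1) ab aa).
have p0 : p 0 = h by rewrite /p mulr0 Q0 !addr0.
have ppi : p pi = B by rewrite /p /c divfK ?lt0r_neq0 ?pi_gt0 //; ring.
suff: th pi <= pi / 2 + -1 * atan (p pi) by rewrite ppi mulN1r.
apply: (angle_compare tt TT); rewrite ?lexx ?ab ?p0 ?mulN1r //.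
- by rewrite t0.
- exact: aeW.
- apply: aeW => x xpi; rewrite /angle_speed add0r mulN1r.
  rewrite cosB sinB cos_pihalf sin_pihalf !mul0r !mul1r add0r subr0 sin_atan.
  have cE : cos (atan (p x)) ^+ 2 = (1 + p x ^+ 2)^-1.
    by rewrite cos_atan exprVn sqr_sqrtr // addr_ge0 ?sqr_ge0.
  rewrite exprMn cE; set D := (1 + p x ^+ 2)^-1.
  have D0 : 0 <= D by rewrite invr_ge0 addr_ge0 ?sqr_ge0.
  have pM : p x ^+ 2 <= M ^+ 2.
    rewrite -real_normK ?num_real // lerXn2r ?nnegrE // HM //.
    exact: subset_itv_oo_cc.
  rewrite -subr_ge0.
  have -> : -1 * (D * (c + q x)) - (p x ^+ 2 * D + (lam - q x) * D) =
    D * (- (c + lam) - p x ^+ 2) by ring.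
  by rewrite mulr_ge0 //; lra.
Qed.

End AngleInLambda.

(** * The index of an eigenvalue *)

Section AngleGap.
Context {R : realType}.

Lemma sinDnatpi (x : R) n : sin (x + n%:R * pi) = (-1) ^+ n * sin x.
Proof. by rewrite mulr_natl (alternatingn (@sinDpi R)). Qed.

Lemma cosDnatpi (x : R) n : cos (x + n%:R * pi) = (-1) ^+ n * cos x.
Proof. by rewrite mulr_natl (alternatingn (@cosDpi R)). Qed.

Lemma sin_natpi n : sin (n%:R * pi) = 0 :> R.
Proof. by rewrite -[_ * pi]add0r sinDnatpi sin0 mulr0. Qed.

Lemma sin_eq0_natpi (x : R) : - pi < x -> sin x = 0 -> exists n : nat, x = n%:R * pi.
Proof.
move=> xpi sx; have pi0 := pi_gt0 R.
have x0 : 0 <= x.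
  rewrite leNgt; apply/negP => x0; have : 0 < sin (- x).
    by apply: sin_gt0_pi; apply/andP; split; lra.
  by rewrite sinN sx oppr0 ltxx.
have := @truncn_itv R (x / pi) (divr_ge0 x0 (ltW pi0)).
set n := Num.trunc _ => /andP[].
rewrite ler_pdivlMr // ltr_pdivrMr // -natr1 mulrDl mul1r => h1 h2; exists n.
apply/eqP; rewrite eq_le h1 andbT leNgt; apply/negP => h3.
have : 0 < sin (x - n%:R * pi) by apply: sin_gt0_pi; apply/andP; split; lra.
have := sx; rewrite -{1}(subrK (n%:R * pi) x) sinDnatpi => /eqP.
by rewrite mulf_eq0 signr_eq0 /= => /eqP ->; rewrite ltxx.
Qed.

Lemma cos_gt0_lt_pihalf (t : R) : `|t| < pi -> 0 < cos t -> `|t| < pi / 2.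
Proof.
rewrite -(cos_norm t); set a := `|t| => api ca; rewrite ltNge; apply/negP => h.
have : 0 <= sin (a - pi / 2) by apply: sin_ge0_pi; have p0 := pi_gt0 R; apply/andP; split; lra.
by rewrite sinBpihalf; lra.
Qed.

(** By continuity |f| would have to take the value pi/2, where the cosine vanishes. The bound on f 0
    selects the branch around 0. *)
Lemma angle_gap (f : R -> R) (b x : R) : {within `[0, b], continuous f} ->
  `|f 0| < pi -> (forall y, 0 <= y <= b -> 0 < cos (f y)) ->
  0 <= x <= b -> `|f x| < pi / 2.
Proof.
move=> cf f0 cpos /andP[x0 xb]; rewrite ltNge; apply/negP => h.
have b0 := le_trans x0 xb.
have g0 : `|f 0| < pi / 2 by apply: cos_gt0_lt_pihalf => //; apply: cpos; rewrite lexx.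
have cg : {within `[0, x], continuous (fun y => `|f y|)}.
  apply: continuous_subspaceW (within_continuousT_comp (@norm_continuous _ _) cf).
  exact: subset_itvl.
have [|c] := IVT x0 cg (v := pi / 2).
  by rewrite ge_min le_max (ltW g0) h orbT.
rewrite in_itv /= => /andP[c0 cx] fc.
have := cpos c; rewrite c0 (le_trans cx) // -cos_norm fc cos_pihalf ltxx => /(_ isT).
by [].
Qed.

End AngleGap.

Lemma strictly_increasing_onto_id (k : nat -> nat) :
  (forall m n, (m < n)%N -> (k m < k n)%N) -> (forall m, exists n, k n = m) ->
  forall n, k n = n.
Proof.
move=> inc onto n; elim/ltn_ind: n => n IH.
have ge m : (m <= k m)%N.
  by elim: m => // m IHm; apply: leq_ltn_trans IHm (inc _ _ _).
have [j kj] := onto n; apply/eqP; rewrite eqn_leq ge andbT.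
have [jn|nj|jE] := ltngtP j n; last by rewrite -{2}kj jE.
  by move: kj; rewrite IH // => jE; rewrite jE ltnn in jn.
by rewrite -{2}kj ltnW // inc.
Qed.

(** * Counting eigenvalues by the total angle *)

Section EigenvalueIndex.
Context {R : realType} (q : R -> R) (h H H1 H2 : R) (phi dphi : R -> R -> R).
Hypothesis qL2 : L2_0pi q.
Hypothesis rho_gt0 : 0 < H * H1 - H2.
Hypothesis phiP : forall lam : R,
  [/\ SL_solution q lam (phi ^~ lam) (dphi ^~ lam), phi 0 lam = 1 & dphi 0 lam = h].
Local Notation rho := (H * H1 - H2).
Implicit Types lam : R.

Lemma phi_ac lam : ac_solution q lam (phi ^~ lam) (dphi ^~ lam).
Proof. by have [/SL_solution_ac] := phiP lam. Qed.

Definition charac lam := (lam - H1) * dphi pi lam + (lam * H - H2) * phi pi lam.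

Lemma SL_eigenvalueP lam : SL_eigenvalue q h H H1 H2 lam <-> charac lam = 0.
Proof.
have [s p0 dp0] := phiP lam; split; last first.
  move=> D0; exists (phi ^~ lam), (dphi ^~ lam); split => //.
  - exists 0; last by rewrite p0 oner_neq0.
    by rewrite in_itv /= lexx pi_ge0.
  - by rewrite p0 dp0 mulr1 subrr.
  - by move: D0; rewrite /charac; lra.
move=> [y [dy [/SL_solution_ac sy [x xpi yx] y0 ypi]]].
have u z : 0 <= z <= pi -> y z = y 0 * phi z lam /\ dy z = y 0 * dphi z lam.
  move=> zpi; have sub := ac_solution_sub (y 0) sy (phi_ac lam).
  have [||e1 e2] := ac_solution_unique qL2 sub _ _ zpi.
  - by rewrite p0 mulr1 subrr.
  - by rewrite dp0; lra.
  - by split; apply/eqP; rewrite -subr_eq0; apply/eqP.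
have [y0E|y00] := eqVneq (y 0) 0.
  move: yx; have [|-> _] := u x; first by move: xpi; rewrite in_itv.
  by rewrite y0E mul0r eqxx.
have [|e1 e2] := u pi; first by rewrite lexx pi_ge0.
apply: (mulfI y00); rewrite mulr0 /charac.
by move: ypi; rewrite e1 e2; lra.
Qed.

Variable theta : R -> R -> R.
Hypothesis thetaP : forall lam, [/\ theta lam 0 = pi / 2 - atan h,
  is_angle q lam (theta lam) &
  forall x, 0 <= x <= pi -> exists2 r : R, 0 < r &
    phi x lam = r * sin (theta lam x) /\ dphi x lam = r * cos (theta lam x)].

(** The inner products of (lam H - H2, H1 - lam) with the orthogonal vectors (1, H) and (H, -1), of
    equal length, are rho and the numerator: the quotient is the tangent of the angle from (1, H),
    measured clockwise. It increases with lam because rho > 0. *)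
Definition bc_slope lam := (lam * (1 + H ^+ 2) - H * H2 - H1) / rho.
Definition bc_angle lam := atan H - atan (bc_slope lam).

(* The vector (lam H - H2, H1 - lam) moves along a line at distance > 0 from the
   origin, whence the closed form bc_angle for its angle. *)
Lemma charac_eq0 lam : charac lam = 0 <-> sin (theta lam pi - bc_angle lam) = 0.
Proof.
have [_ _ lift] := thetaP lam; have [|r r0 [pE dpE]] := lift pi; first by rewrite lexx pi_ge0.
have ca := cos_atan_gt0 H; have ct := cos_atan_gt0 (bc_slope lam).
have H0 : 0 < 1 + H ^+ 2 by rewrite ltr_pwDl // sqr_ge0.
have E : r * sin (theta lam pi - bc_angle lam) =
    cos (atan H) * cos (atan (bc_slope lam)) * (1 + H ^+ 2) / rho * charac lam.
  rewrite /charac pE dpE /bc_angle sinB sinB cosB !sin_atan.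
  set c1 := cos (atan H); set c2 := cos (atan (bc_slope lam)).
  by rewrite /bc_slope; field; exact: lt0r_neq0.
split => [D0|s0]; last first.
  move/eqP: E; rewrite s0 mulr0 eq_sym mulf_eq0 => /orP[|/eqP //].
  by rewrite gt_eqF // !mulr_gt0 // invr_gt0.
by move/eqP: E; rewrite D0 mulr0 mulf_eq0 (gt_eqF r0) => /eqP.
Qed.

Definition total_angle lam := theta lam pi - bc_angle lam.

Lemma bc_slope_lt lam lam' : lam < lam' -> bc_slope lam < bc_slope lam'.
Proof.
move=> ll; rewrite /bc_slope ltr_pM2r ?invr_gt0 // !ltrD2r ltr_pM2r //.
by rewrite ltr_pwDl // sqr_ge0.
Qed.

Lemma theta_le lam lam' : lam <= lam' -> theta lam pi <= theta lam' pi.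
Proof.
have [t0 tt _] := thetaP lam; have [t0' tt' _] := thetaP lam'.
by move=> ll; apply: (is_angle_le qL2 ll tt tt'); rewrite ?t0 ?t0' // lexx pi_ge0.
Qed.

Lemma total_angle_lt lam lam' : lam < lam' -> total_angle lam < total_angle lam'.
Proof.
move=> ll; rewrite /total_angle ler_ltB ?theta_le ?(ltW ll) //.
by rewrite /bc_angle ltrD2l ltrN2; apply: lt_atan; exact: bc_slope_lt.
Qed.

Lemma total_angle_gtNpi lam : - pi < total_angle lam.
Proof.
have [t0 tt _] := thetaP lam.
have := is_angle_ge0 qL2 tt _ (_ : 0 <= pi <= pi); rewrite t0 lexx pi_ge0.
have := atan_ltpi2 h; have := atan_ltpi2 H; have := atan_gtNpi2 (bc_slope lam).
rewrite /total_angle /bc_angle => ? ? ? t1; have {}t1 := t1 _ isT.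
suff : 0 <= theta lam pi by lra.
by apply: t1; lra.
Qed.

Lemma total_angle_neg : exists lam, total_angle lam < 0.
Proof.
(* [bc_angle] is positive exactly for lam < H1, so [H1 - 1] gives a threshold b0 in ]0, pi[. Further
   left, [bc_angle] exceeds b0 while theta(pi) is pushed below b0. *)
pose b0 := bc_angle (H1 - 1).
have b0pos : 0 < b0.
  rewrite subr_gt0; apply: lt_atan; rewrite ltr_pdivrMr //.
  by have := sqr_ge0 H; lra.
have b0pi : b0 < pi.
  by rewrite /b0 /bc_angle; have := atan_ltpi2 H; have := atan_gtNpi2 (bc_slope (H1 - 1)); lra.
have [L HL] := is_angle_small qL2 h (tan (pi / 2 - b0)).
pose lam := Num.min L (H1 - 2); exists lam.
have lamL : lam <= L by rewrite ge_min lexx.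
have lamH : lam < H1 - 1.
  by apply: (@le_lt_trans _ _ (H1 - 2)); [rewrite ge_min lexx orbT|lra].
have [t0 tt _] := thetaP lam.
have := HL _ _ lamL tt t0; rewrite tanK; last first.
  by rewrite in_itv /=; apply/andP; split; lra.
have : b0 < bc_angle lam.
  by rewrite /b0 /bc_angle ltrD2l ltrN2; apply: lt_atan; exact: bc_slope_lt.
by rewrite /total_angle; lra.
Qed.

Lemma continuous_total_angle : continuous total_angle.
Proof.
have cb : continuous bc_angle.
  move=> lam; apply: cvgB; first exact: cvg_cst.
  apply: (@continuous_comp _ _ _ bc_slope (@atan R)); last exact: continuous_atan.
  apply: cvgM; last exact: cvg_cst.
  by do ![apply: cvgB; last exact: cvg_cst]; apply: cvgM; [exact: cvg_id|exact: cvg_cst].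
move=> lam; apply: cvgB; last exact: cb.
pose L := `|lam| + 1.
pose C := pi * expR (normq_int q pi + (L + 1) * pi).
have C0 : 0 < C by rewrite mulr_gt0 ?pi_gt0 ?expR_gt0.
have lip l l' : l <= l' -> `|l| <= L -> theta l' pi - theta l pi <= (l' - l) * C.
  move=> ll lL; have [t0 tt _] := thetaP l; have [t0' tt' _] := thetaP l'.
  by apply: (is_angle_lipschitz qL2 lL ll tt tt'); rewrite t0 t0'.
apply/cvgrPdist_le => e e0.
near=> l.
have h1 : `|lam - l| < 1 by near: l; exact: (@cvgr_dist_lt _ _ _ _ _ id).
have h2 : `|lam - l| < e / C.
  by near: l; apply: (@cvgr_dist_lt _ _ _ _ _ id) => //; exact: divr_gt0.
have lL : `|l| <= L.
  have := ler_normD (l - lam) lam; rewrite subrK distrC /L; lra.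
have lamL : `|lam| <= L by rewrite /L; lra.
move: h2; rewrite ltr_pdivlMr //.
case: (leP l lam) => ll.
  rewrite !ger0_norm ?subr_ge0 ?theta_le // => h2.
  by have := lip _ _ ll lL; lra.
rewrite !ler0_norm ?subr_le0 ?theta_le ?(ltW ll) // => h2.
by have := lip _ _ (ltW ll) lamL; lra.
Unshelve. all: by end_near. Qed.

(** The vectors (phi', phi) and (phi', s phi) have positive inner product phi'^2 + s phi^2, and both
    initial angles lie in ]0, pi[. The last clause is what transfers the index from theta to psi. *)
Lemma scaled_angle (s : R) : 0 < s -> exists psi : R -> R,
  [/\ psi 0 = pi / 2 - atan (h / s),
      ac_derive 0 pi psi (fun x => s - sin (psi x) ^+ 2 / s * q x),
      forall x, 0 <= x <= pi -> exists2 r : R, 0 < r &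
        s * phi x (s ^+ 2) = r * sin (psi x) /\ dphi x (s ^+ 2) = r * cos (psi x) &
      forall x, 0 <= x <= pi -> `|theta (s ^+ 2) x - psi x| < pi / 2].
Proof.
move=> s0; have [_ p0 dp0] := phiP (s ^+ 2).
have [psi [psi0 pp lift]] := prufer_angle qL2 s0 (phi_ac (s ^+ 2)) p0 dp0.
exists psi; split => //.
  apply: (ac_derive_ext pp) => x _.
  by rewrite cos2sin2; field; exact: lt0r_neq0.
have [t0 tt tlift] := thetaP (s ^+ 2).
have cg : {within `[0, pi], continuous (fun x => theta (s ^+ 2) x - psi x)}.
  move=> x; apply: cvgB; first exact: (ac_derive_within tt).
  exact: (ac_derive_within pp).
move=> x xpi; apply: (angle_gap cg) xpi.
  rewrite t0 psi0 ltr_norml; have := atan_ltpi2 h; have := atan_gtNpi2 h.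
  by have := atan_ltpi2 (h / s); have := atan_gtNpi2 (h / s) => *; apply/andP; split; lra.
move=> y ypi; have [r1 r10 [e1 e2]] := tlift y ypi; have [r2 r20 [e3 e4]] := lift y ypi.
have e0 : 0 < phi y (s ^+ 2) ^+ 2 + dphi y (s ^+ 2) ^+ 2.
  rewrite e1 e2 !exprMn -mulrDr addrC cos2Dsin2 mulr1; exact: exprn_gt0.
rewrite cosB -(pmulr_rgt0 _ (mulr_gt0 r10 r20)).
have -> : r1 * r2 * (cos (theta (s ^+ 2) y) * cos (psi y) +
    sin (theta (s ^+ 2) y) * sin (psi y)) =
  dphi y (s ^+ 2) ^+ 2 + s * phi y (s ^+ 2) ^+ 2.
  transitivity ((r1 * cos (theta (s ^+ 2) y)) * (r2 * cos (psi y)) +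
    (r1 * sin (theta (s ^+ 2) y)) * (r2 * sin (psi y))); first by ring.
  by rewrite -e1 -e2 -e3 -e4; ring.
have [d0|d0] := eqVneq (dphi y (s ^+ 2)) 0.
  by move: e0; rewrite d0 expr0n /= addr0 add0r => e0; exact: mulr_gt0.
by apply: ltr_pwDl; [rewrite exprn_even_gt0|rewrite mulr_ge0 ?sqr_ge0 // ltW].
Qed.

Lemma scaled_angle_bound (s x : R) psi : 0 < s ->
  ac_derive 0 pi psi (fun x => s - sin (psi x) ^+ 2 / s * q x) -> 0 <= x <= pi ->
  `|psi x - psi 0 - s * x| <= normq_int q pi / s.
Proof.
move=> s0 pp xpi; have /andP[x0 xp] := xpi; have ab := pi_ge0 R.
have /andP[n0 n1] := normq_int_le qL2 xpi.
have sub := ac_derive_sub (lexx 0) xp.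
have nq := ac_deriveZ s^-1 ab (ac_derive_normq_int qL2).
have key z : `|sin (psi z) ^+ 2 / s * q z| <= s^-1 * `|q z|.
  rewrite normrM ler_wpM2r // normrM (ger0_norm (x := s^-1)) ?invr_ge0 ?(ltW s0) //.
  rewrite ler_piMl ?invr_ge0 ?(ltW s0) // ger0_norm ?sqr_ge0 //.
apply: (@le_trans _ _ (s^-1 * normq_int q x)); last first.
  by rewrite mulrC ler_wpM2r // invr_ge0 ltW.
have dd := ac_deriveD pp (ac_deriveZ (- s) ab (ac_derive_id 0 pi)).
have := ac_derive_le x0 (sub _ _ (ac_deriveD nq dd)).
have := ac_derive_le x0 (sub _ _ (ac_deriveD nq (ac_deriveZ (-1) ab dd))).
move=> h1 h2; lapply h1; last first.
  by apply: aeW => z _; have := key z; rewrite ler_norml => /andP[? ?]; lra.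
lapply h2; last first.
  by apply: aeW => z _; have := key z; rewrite ler_norml => /andP[? ?]; lra.
rewrite normq_int0 /= => ? ?; rewrite ler_norml; apply/andP; split; lra.
Qed.

Lemma total_angle_unbounded (B : R) : exists lam, B < total_angle lam.
Proof.
have pi0 := pi_gt0 R; have pipi : 0 <= (pi : R) <= pi by rewrite pi_ge0 lexx.
have /andP[n0 _] := normq_int_le qL2 pipi.
(* The summands pay for B, for [bc_angle] together with the gap pi/2 between the angles, and for the
   deviation of psi from s x; 1 ensures s >= 1. *)
pose s := 1 + `|B| + 4 * pi + normq_int q pi.
have s1 : 1 <= s by rewrite /s; have := normr_ge0 B; lra.
have s0 : 0 < s by lra.
have [psi [psi0 pp _ close]] := scaled_angle s0.
exists (s ^+ 2).
have := close pi pipi; rewrite ltr_norml => /andP[c1 _].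
have := scaled_angle_bound s0 pp pipi; rewrite ler_norml => /andP[c2 _].
have c3 : normq_int q pi / s <= normq_int q pi by rewrite ler_pdivrMr // ler_peMr.
have c4 : s <= s * pi by rewrite ler_peMr // ?ltW //; have := pi_ge2 R; lra.
rewrite /total_angle /bc_angle.
have := atan_ltpi2 H; have := atan_gtNpi2 (bc_slope (s ^+ 2)); have := atan_ltpi2 (h / s).
have := ler_norm B; move: c4 c1 c2 c3; rewrite psi0 {1}/s; lra.
Qed.

Variable lambda : nat -> R.
Hypothesis lambda_lt : forall m n : nat, (m < n)%N -> lambda m < lambda n.
Hypothesis lambda_range : [set lam | SL_eigenvalue q h H H1 H2 lam] = range lambda.

Lemma lambda_charac n : charac (lambda n) = 0.
Proof.
by apply/SL_eigenvalueP; have : range lambda (lambda n) by []; rewrite -lambda_range.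
Qed.

(** The multiples attached to the eigenvalues increase strictly. Every natural multiple occurs: the
    intermediate value theorem gives a lam, which is then an eigenvalue and so in the range of
    [lambda]. A strictly increasing surjection of the naturals is the identity. *)
Lemma total_angle_lambda n : total_angle (lambda n) = n%:R * pi.
Proof.
have zero m : {k : nat | total_angle (lambda m) = k%:R * pi}.
  apply/cid/(sin_eq0_natpi (total_angle_gtNpi _)).
  by apply/charac_eq0; exact: lambda_charac.
pose k m := sval (zero m); have kE m : total_angle (lambda m) = (k m)%:R * pi := svalP (zero m).
rewrite kE; congr (_%:R * _); apply: strictly_increasing_onto_id => [i j ij|m].
  have := total_angle_lt (lambda_lt ij).
  by rewrite !kE ltr_pM2r ?pi_gt0 // ltr_nat.
have [l1 l1P] := total_angle_neg; have [l2 l2P] := total_angle_unbounded (m%:R * pi).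
have m0 : 0 <= m%:R * pi :> R by rewrite mulr_ge0 ?pi_ge0.
have l12 : l1 <= l2.
  by rewrite leNgt; apply/negP => /total_angle_lt; lra.
have [|lam _ lamE] := IVT l12 (continuous_subspaceT continuous_total_angle) (v := m%:R * pi).
  by rewrite ge_min le_max (ltW l2P) orbT andbT (le_trans (ltW l1P)).
have : [set lam | SL_eigenvalue q h H H1 H2 lam] lam.
  by apply/SL_eigenvalueP/charac_eq0; rewrite -[_ - _]/(total_angle lam) lamE sin_natpi.
rewrite lambda_range => -[j _ jE]; exists j; apply/eqP.
have := kE j; rewrite jE lamE => /(mulIf (lt0r_neq0 (pi_gt0 R)))/eqP.
by rewrite eqr_nat eq_sym.
Qed.

Lemma lambda_unbounded (B : R) : exists N : nat, forall n, (N <= n)%N -> B < lambda n.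
Proof.
have pi0 := pi_gt0 R.
exists (Num.trunc (`|total_angle B| / pi)).+1 => n nN.
rewrite ltNge; apply/negP; rewrite le_eqVlt => bad.
have : total_angle (lambda n) <= total_angle B.
  by case/orP: bad => [/eqP -> //|/total_angle_lt/ltW].
rewrite total_angle_lambda; apply/negP; rewrite -ltNge.
apply: (le_lt_trans (ler_norm _)); rewrite -ltr_pdivrMr //.
have := @truncn_itv R (`|total_angle B| / pi) (divr_ge0 (normr_ge0 _) (ltW pi0)).
by move=> /andP[_ h1]; apply: (lt_le_trans h1); rewrite ler_nat.
Qed.

(** For t = psi(pi) - n pi - pi/2 the boundary condition yields tan t, hence t modulo pi. As s^2 >
    H1, [bc_angle] lies in ]-pi, 0[, so theta(pi) = bc_angle + (n + 1) pi lies in ]n pi, (n + 1) pi[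
    and phi(pi) has the sign of (-1)^n; this means cos t > 0. *)
Lemma scaled_angle_at_eigenvalue n (s : R) (psi : R -> R) : 0 < s -> H1 < s ^+ 2 ->
  lambda n.+1 = s ^+ 2 ->
  (exists2 r : R, 0 < r &
     s * phi pi (s ^+ 2) = r * sin (psi pi) /\ dphi pi (s ^+ 2) = r * cos (psi pi)) ->
  `|theta (s ^+ 2) pi - psi pi| < pi / 2 ->
  psi pi = n%:R * pi + pi / 2 + atan ((s ^+ 2 * H - H2) / ((s ^+ 2 - H1) * s)).
Proof.
move=> s0 H1s ls [r r0 [e1 e2]] close.
have pi0 := pi_gt0 R; have s2 : 0 < s ^+ 2 - H1 by rewrite subr_gt0.
have [t psiE] : exists t, psi pi = (t + pi / 2) + n%:R * pi.
  by exists (psi pi - n%:R * pi - pi / 2); ring.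
have tE := total_angle_lambda n.+1; rewrite ls /total_angle in tE.
have b0 : bc_angle (s ^+ 2) < 0.
  rewrite subr_lt0; apply: lt_atan; rewrite ltr_pdivlMr //.
  have -> : s ^+ 2 * (1 + H ^+ 2) - H * H2 - H1 = H * rho + (s ^+ 2 - H1) * (1 + H ^+ 2).
    by ring.
  by rewrite ltrDl mulr_gt0 // ltr_pwDl // sqr_ge0.
have bpi : - pi < bc_angle (s ^+ 2).
  by rewrite /bc_angle; have := atan_gtNpi2 H; have := atan_ltpi2 (bc_slope (s ^+ 2)); lra.
have thE : theta (s ^+ 2) pi = bc_angle (s ^+ 2) + n.+1%:R * pi by lra.
have sE : s * phi pi (s ^+ 2) = r * ((-1) ^+ n * cos t).
  by rewrite e1 psiE sinDnatpi sinDpihalf.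
have cE : dphi pi (s ^+ 2) = - (r * ((-1) ^+ n * sin t)).
  by rewrite e2 psiE cosDnatpi cosDpihalf; ring.
have [_ _ tlift] := thetaP (s ^+ 2).
have [|r1 r10 [e3 _]] := tlift pi; first by rewrite lexx ltW.
have cost : 0 < cos t.
  have sb : 0 < sin (- bc_angle (s ^+ 2)) by apply: sin_gt0_pi; apply/andP; split; lra.
  move: sE; rewrite e3 thE sinDnatpi exprS => sE.
  have : r * cos t = s * r1 * sin (- bc_angle (s ^+ 2)).
    have sgn : (-1) ^+ n * (-1) ^+ n = 1 :> R by rewrite -expr2 sqrr_sign.
    transitivity (((-1) ^+ n * (-1) ^+ n) * (r * cos t)); first by rewrite sgn mul1r.
    transitivity ((-1) ^+ n * (r * ((-1) ^+ n * cos t))); first by ring.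
    rewrite -sE sinN.
    transitivity ((-1) ^+ n * (-1) ^+ n * (s * r1 * - sin (bc_angle (s ^+ 2)))); first by ring.
    by rewrite sgn mul1r.
  move=> E; rewrite -(pmulr_rgt0 _ r0) E mulr_gt0 // mulr_gt0 //.
(* The gap below pi/2 puts t strictly between [bc_angle] and [bc_angle] + pi. *)
have tpi : `|t| < pi.
  have nE : n.+1%:R * pi = n%:R * pi + pi :> R by rewrite -natr1 mulrDl mul1r.
  by move: close; rewrite thE psiE nE !ltr_norml => /andP[? ?]; apply/andP; split; lra.
have := cos_gt0_lt_pihalf tpi cost; rewrite ltr_norml => tpi2.
have tanE : tan t = (s ^+ 2 * H - H2) / ((s ^+ 2 - H1) * s).
  have := lambda_charac n.+1; rewrite ls /charac cE => D.
  have {}D : r * (-1) ^+ n * ((s ^+ 2 * H - H2) * cos t - (s ^+ 2 - H1) * s * sin t) = 0.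
    transitivity ((s ^+ 2 * H - H2) * (r * ((-1) ^+ n * cos t)) -
      (s ^+ 2 - H1) * s * (r * ((-1) ^+ n * sin t))); first by ring.
    rewrite -sE; transitivity (s * ((s ^+ 2 - H1) * - (r * ((-1) ^+ n * sin t)) +
      (s ^+ 2 * H - H2) * phi pi (s ^+ 2))); first by ring.
    by rewrite D mulr0.
  move/eqP: D; rewrite mulf_eq0 mulf_eq0 (gt_eqF r0) signr_eq0 /= subr_eq0 => /eqP D.
  apply/eqP; rewrite /tan eqr_div ?lt0r_neq0 ?mulr_gt0 //.
  by rewrite D mulrC.
rewrite psiE -tanE tanK ?in_itv //=; ring.
Qed.

End EigenvalueIndex.

(** * Asymptotics *)

Lemma atan_norm_le {R : realType} (x : R) : `|atan x| <= `|x|.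
Proof.
have := @lipschitz_of_derive R (@atan R) (fun y => (1 + y ^+ 2)^-1) 1 (@is_derive1_atan R) _ x 0.
rewrite atan0 !subr0 mul1r; apply => y.
have y1 : 1 <= 1 + y ^+ 2 by rewrite lerDl sqr_ge0.
by rewrite ger0_norm ?invr_ge0 ?(le_trans ler01) // invf_le1 // (lt_le_trans ltr01).
Qed.

Lemma atan_sub_le {R : realType} (x : R) : `|atan x - x| <= x ^+ 2.
Proof.
wlog x0 : x / 0 <= x => [W|].
  have [/W//|/ltW x0] := leP 0 x; have := W (- x).
  by rewrite atanN -opprB opprK normrN addrC distrC sqrrN; apply; rewrite oppr_ge0.
have dk (y : R) : is_derive y 1 (fun y => atan y - y) ((1 + y ^+ 2)^-1 - 1).
  by apply: is_deriveB.
have [|c] := @MVT_segment R _ _ 0 x x0 (fun z _ => dk z).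
  by apply: derivable_within_continuous => z _; have [] := dk z.
rewrite in_itv /= atan0 !subr0 => /andP[c0 cx] ->.
have c1 : 0 < 1 + c ^+ 2 by rewrite ltr_pwDl // sqr_ge0.
have -> : (1 + c ^+ 2)^-1 - 1 = - (c ^+ 2 / (1 + c ^+ 2)) by field; exact: lt0r_neq0.
rewrite mulNr normrN ger0_norm; last first.
  by rewrite mulr_ge0 // divr_ge0 ?sqr_ge0 // ltW.
rewrite expr2 ler_wpM2r // (le_trans _ cx) // ler_pdivrMr //.
have : 0 <= c * (c - 1) ^+ 2 by rewrite mulr_ge0 ?sqr_ge0.
have : 0 <= c * c by rewrite mulr_ge0.
by have := mulr_ge0 c0 (mulr_ge0 c0 c0); lra.
Qed.

Lemma sin_cos_lipschitz {R : realType} (x y : R) :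
  `|sin x * cos x - sin y * cos y| <= `|x - y|.
Proof.
have -> : sin x * cos x - sin y * cos y = (sin (x *+ 2) - sin (y *+ 2)) / 2.
  by rewrite !sin_mulr2n; lra.
rewrite normrM (ger0_norm (x := 2^-1)) ?invr_ge0 // ler_pdivrMr //.
by apply: (le_trans (sin_lipschitz _ _)); rewrite -mulrnBl normrMn mulr_natr.
Qed.

Section Asymptotics.
Context {R : realType} (q : R -> R) (h H H1 H2 : R) (phi dphi : R -> R -> R).
Hypothesis qL2 : L2_0pi q.
Hypothesis rho_gt0 : 0 < H * H1 - H2.
Hypothesis phiP : forall lam : R,
  [/\ SL_solution q lam (phi ^~ lam) (dphi ^~ lam), phi 0 lam = 1 & dphi 0 lam = h].
Variable lambda : nat -> R.
Hypothesis lambda_lt : forall m n : nat, (m < n)%N -> lambda m < lambda n.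
Hypothesis lambda_range : [set lam | SL_eigenvalue q h H H1 H2 lam] = range lambda.
Local Notation rho := (H * H1 - H2).
Local Notation mu := (@lebesgue_measure R).
Local Notation cont f := {within `[0, pi], continuous f}.
Local Notation A := (normq_int q pi).

Lemma exists_theta : exists theta : R -> R -> R, forall lam, [/\ theta lam 0 = pi / 2 - atan h,
  is_angle q lam (theta lam) &
  forall x, 0 <= x <= pi -> exists2 r : R, 0 < r &
    phi x lam = r * sin (theta lam x) /\ dphi x lam = r * cos (theta lam x)].
Proof.
suff /choice[theta thetaP] : forall lam, exists th : R -> R, [/\ th 0 = pi / 2 - atan h,
    is_angle q lam th &
    forall x, 0 <= x <= pi -> exists2 r : R, 0 < r &
      phi x lam = r * sin (th x) /\ dphi x lam = r * cos (th x)].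
  by exists theta.
move=> lam; have [_ p0 dp0] := phiP lam.
have [th [th0 tt lift]] := prufer_angle qL2 ltr01 (phi_ac phiP lam) p0 dp0.
exists th; split.
- by rewrite th0 divr1.
- by apply: (ac_derive_ext tt) => x _; rewrite /angle_speed mul1r divr1.
- by move=> x /lift [r r0 [e1 e2]]; exists r => //; rewrite -e1 mul1r.
Qed.

Lemma eigenvalue_unbounded (B : R) : exists N : nat, forall n, (N <= n)%N -> B < lambda n.
Proof.
by have [theta thetaP] := exists_theta; exact: (lambda_unbounded qL2 rho_gt0 phiP thetaP).
Qed.

Definition bc_tan (s : R) := (s ^+ 2 * H - H2) / ((s ^+ 2 - H1) * s).

Lemma eigenvalue_angle n (s : R) : 0 < s -> H1 < s ^+ 2 -> lambda n.+1 = s ^+ 2 ->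
  exists psi : R -> R,
  [/\ psi 0 = pi / 2 - atan (h / s),
      ac_derive 0 pi psi (fun x => s - sin (psi x) ^+ 2 / s * q x),
      forall x, 0 <= x <= pi -> exists2 r : R, 0 < r &
        s * phi x (s ^+ 2) = r * sin (psi x) /\ dphi x (s ^+ 2) = r * cos (psi x) &
      psi pi = n%:R * pi + pi / 2 + atan (bc_tan s)].
Proof.
move=> s0 H1s ls; have [theta thetaP] := exists_theta.
have [psi [psi0 pp lift close]] := scaled_angle qL2 phiP thetaP s0.
have pipi : 0 <= (pi : R) <= pi by rewrite pi_ge0 lexx.
exists psi; split => //; apply: (scaled_angle_at_eigenvalue _ _ _ thetaP _ _ _ _ ls) => //.
- exact: lift.
- exact: close.
Qed.

Lemma integral_mul_potential_le (f : R -> R) (M : R) : cont f ->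
  (forall x, 0 <= x <= pi -> `|f x| <= M) ->
  `|\int[mu]_(x in `[0, pi]) (f x * q x)| <= M * A.
Proof.
move=> cf fM; have ab := pi_ge0 R.
have iq := L2_0pi_integrable qL2.
have mI : measurable (`[0, pi]%classic : set R) by exact: measurable_itv.
have ifq := integrable_within_continuousM ab cf iq.
apply: (le_trans (le_normr_Rintegral _ ifq)) => //.
rewrite -RintegralZl //; last exact: integrable_norm_potential.
apply: le_Rintegral => //.
- exact: (integrable_norm ifq).
- by apply: (integrableZl _ M (integrable_norm_potential qL2)).
by move=> x /=; rewrite in_itv /= normrM => /fM ?; rewrite ler_wpM2r.
Qed.

Let A_ge0 : 0 <= A.
Proof. by have /andP[] := normq_int_le qL2 (introT andP (conj (pi_ge0 R) (lexx _))). Qed.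

(** The frequency is real because the estimates produce these integrals at s, the root of an
    eigenvalue, while Bessel's inequality controls them at integers. *)
Definition cos_coef (s : R) := \int[mu]_(x in `[0, pi]) (cos (2 * s * x) * q x).
Definition sin_coef (s : R) := \int[mu]_(x in `[0, pi]) ((pi - x) * sin (2 * s * x) * q x).

Let contD (f g : R -> R) : cont f -> cont g -> cont (fun x => f x + g x).
Proof. exact: within_continuousD. Qed.

Let cont_cos (s : R) : cont (fun x : R => cos (2 * s * x)).
Proof. exact: within_continuous_scale (@continuous_cos R). Qed.

Let cont_sin (s : R) : cont (fun x : R => (pi - x) * sin (2 * s * x)).
Proof.
apply: within_continuousM; last exact: within_continuous_scale (@continuous_sin R).
by apply: continuous_subspaceT => x; apply: cvgB; [exact: cvg_cst|exact: cvg_id].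
Qed.

Lemma integral_mul_potentialB (f g : R -> R) (M : R) : cont f -> cont g ->
  (forall x, 0 <= x <= pi -> `|f x - g x| <= M) ->
  `|\int[mu]_(x in `[0, pi]) (f x * q x) - \int[mu]_(x in `[0, pi]) (g x * q x)| <= M * A.
Proof.
move=> cf cg fgM; have ab := pi_ge0 R; have iq := L2_0pi_integrable qL2.
rewrite -RintegralB //; do ?exact: (integrable_within_continuousM ab _ iq).
have cfg : cont (fun x => f x - g x) by move=> x; apply: cvgB; [exact: cf|exact: cg].
have := integral_mul_potential_le cfg fgM; congr (`|_| <= _).
by apply: eq_Rintegral => x _; rewrite mulrBl.
Qed.

Lemma cos_coef_lipschitz (s t : R) : `|cos_coef s - cos_coef t| <= 2 * pi * `|s - t| * A.
Proof.
apply: integral_mul_potentialB => // x /andP[x0 xpi].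
apply: (le_trans (cos_lipschitz _ _)).
have -> : 2 * s * x - 2 * t * x = (2 * x) * (s - t) by ring.
by rewrite normrM ler_wpM2r // ger0_norm ?mulr_ge0 // ler_pM2l.
Qed.

Lemma sin_coef_lipschitz (s t : R) :
  `|sin_coef s - sin_coef t| <= pi * (2 * pi * `|s - t|) * A.
Proof.
apply: integral_mul_potentialB => // x /andP[x0 xpi].
rewrite -mulrBr normrM; apply: ler_pM => //.
  by rewrite ger0_norm ?subr_ge0 // gerBl.
apply: (le_trans (sin_lipschitz _ _)).
have -> : 2 * s * x - 2 * t * x = (2 * x) * (s - t) by ring.
by rewrite normrM ler_wpM2r // ger0_norm ?mulr_ge0 // ler_pM2l.
Qed.

(** * Estimates at one large eigenvalue, with constants independent of it *)

Section AtLargeEigenvalue.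
Variables (n : nat) (s : R).
Hypotheses (s_ge1 : 1 <= s) (sH1 : 2 * `|H1| <= s ^+ 2) (lambda_s : lambda n.+1 = s ^+ 2).

Let s_gt0 : 0 < s. Proof. exact: lt_le_trans s_ge1. Qed.
Let s2_gt0 : 0 < s ^+ 2. Proof. exact: exprn_gt0. Qed.

Let half_le : s ^+ 2 / 2 <= s ^+ 2 - H1.
Proof. by have := ler_norm H1; move: sH1; lra. Qed.

Let den_gt0 : 0 < s ^+ 2 - H1.
Proof. by have := half_le; have := s2_gt0; lra. Qed.

Lemma bc_tan_bound : `|bc_tan s - H / s| <= 2 * rho / s ^+ 2.
Proof.
have -> : bc_tan s - H / s = rho / ((s ^+ 2 - H1) * s).
  by rewrite /bc_tan; field; rewrite !lt0r_neq0.
rewrite ger0_norm; last by rewrite divr_ge0 ?(ltW rho_gt0) // mulr_ge0 ?ltW.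
rewrite [2 * rho]mulrC -mulrA ler_pM2l //.
rewrite -[2]invrK -invfM lef_pV2 ?posrE ?mulr_gt0 ?invr_gt0 //.
by apply: (@le_trans _ _ (s ^+ 2 - H1)); [have := half_le; lra|rewrite ler_peMr // ltW].
Qed.

Lemma bc_tan_small : `|bc_tan s| <= (`|H| + 2 * rho) / s.
Proof.
have := ler_normD (H / s) (bc_tan s - H / s); rewrite addrC subrK => /le_trans; apply.
rewrite mulrDl normrM [`|s^-1|]ger0_norm ?invr_ge0 ?(ltW s_gt0) // lerD2l.
apply: (le_trans bc_tan_bound); rewrite ler_pM2l ?mulr_gt0 //.
by rewrite lef_pV2 ?posrE // expr2 ler_peMr // ltW.
Qed.

Let C1 := `|h| + A.

Lemma angle_approx psi x : psi 0 = pi / 2 - atan (h / s) ->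
  ac_derive 0 pi psi (fun x => s - sin (psi x) ^+ 2 / s * q x) -> 0 <= x <= pi ->
  `|psi x - (s * x + pi / 2)| <= C1 / s.
Proof.
move=> psi0 pp xpi; have := scaled_angle_bound qL2 s_gt0 pp xpi.
have := atan_norm_le (h / s); rewrite normrM [`|s^-1|]ger0_norm ?invr_ge0 ?(ltW s_gt0) //.
rewrite psi0 [C1 / s]mulrDl => h1 h2.
have := ler_normD (psi x - (pi / 2 - atan (h / s)) - s * x) (- atan (h / s)).
rewrite normrN [X in `|X| <= _](_ : _ = psi x - (s * x + pi / 2)); last by ring.
by lra.
Qed.

Let C2 := (`|H| + 2 * rho) ^+ 2 + 2 * rho + h ^+ 2 + C1 * A.

Lemma sqrt_eigenvalue_first :
  `|pi * (s - n%:R) - (omega q h H + cos_coef s / 2) / s| <= C2 / s ^+ 2.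
Proof.
have ab := pi_ge0 R; have H1s : H1 < s ^+ 2 by rewrite -subr_gt0.
have [psi [psi0 pp lift psipi]] := eigenvalue_angle s_gt0 H1s lambda_s.
have cpsi := ac_derive_within pp.
have cs2 : cont (fun x => sin (psi x) ^+ 2).
  apply: (within_continuousT_comp (@exprn_continuous R 2)).
  exact: (within_continuousT_comp (@continuous_sin R) cpsi).
pose J := \int[mu]_(x in `[0, pi]) (sin (psi x) ^+ 2 * q x).
have iq := L2_0pi_integrable qL2.
have cc (k : R) : cont (fun=> k) := @within_continuous_cst R _ k.
have mI : measurable (`[0, pi]%classic : set R) by exact: measurable_itv.
have JE : - s^-1 * J = psi pi - psi 0 - s * pi.
  have i2 := integrable_within_continuousM ab cs2 iq.
  have pp' : ac_derive 0 pi (fun x => psi x + - s * x) (fun x => - s^-1 * (sin (psi x) ^+ 2 * q x)).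
    have := ac_deriveD pp (ac_deriveZ (- s) ab (ac_derive_id 0 pi)).
    by congr ac_derive; apply/funext => x; field; exact: lt0r_neq0.
  have iJ : mu.-integrable `[0, pi] (EFin \o (fun x => - s^-1 * (sin (psi x) ^+ 2 * q x))).
    by apply: (integrableZl _ (- s^-1) i2).
  have := ac_derive_FTC ab pp' iJ.
  have -> : \int[mu]_(x in `[0, pi]) (- s^-1 * (sin (psi x) ^+ 2 * q x)) = - s^-1 * J.
    by rewrite RintegralZl.
  by move=> ->; ring.
have Jbound : `|J - \int[mu]_(x in `[0, pi]) ((1 / 2 + cos (2 * s * x) / 2) * q x)| <= C1 / s * A.
  apply: integral_mul_potentialB => // [|x xpi].
    apply: contD; first exact: cc.
    by apply: within_continuousM => //; exact: cont_cos.
  have -> : 1 / 2 + cos (2 * s * x) / 2 = sin (s * x + pi / 2) ^+ 2.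
    rewrite sinDpihalf.
    have -> : 2 * s * x = (s * x) *+ 2 by rewrite -[RHS]mulr_natl mulrA.
    by rewrite cos_mulr2n; lra.
  by apply: (le_trans (sin2_lipschitz _ _)); exact: angle_approx.
have JL : \int[mu]_(x in `[0, pi]) ((1 / 2 + cos (2 * s * x) / 2) * q x) =
    2^-1 * \int[mu]_(x in `[0, pi]) q x + cos_coef s / 2.
  have icq : mu.-integrable `[0, pi] (EFin \o (fun x => cos (2 * s * x) * q x)).
    by apply: integrable_within_continuousM => //; exact: cont_cos.
  have iq' : mu.-integrable `[0, pi] (EFin \o (fun x => 2^-1 * q x)).
    by apply: (integrableZl _ 2^-1 iq).
  have icq' : mu.-integrable `[0, pi] (EFin \o (fun x => 2^-1 * (cos (2 * s * x) * q x))).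
    by apply: (integrableZl _ 2^-1 icq).
  transitivity (\int[mu]_(x in `[0, pi]) (2^-1 * q x + 2^-1 * (cos (2 * s * x) * q x))).
    by apply: eq_Rintegral => x _; field.
  by rewrite RintegralD // !RintegralZl // [_^-1 * cos_coef s]mulrC.
rewrite JL in Jbound.
(* An exact identity. Its terms supply H/s, h/s and the part of omega coming from q together with
   [cos_coef]. *)
have E : pi * (s - n%:R) = atan (bc_tan s) + atan (h / s) + J / s.
  by move: JE; rewrite psipi psi0 [J / s]mulrC; lra.
have a1 := atan_sub_le (bc_tan s); have a2 := atan_sub_le (h / s).
have a3 := bc_tan_bound; have a4 := bc_tan_small.
have a5 : bc_tan s ^+ 2 <= (`|H| + 2 * rho) ^+ 2 / s ^+ 2.
  have -> : (`|H| + 2 * rho) ^+ 2 / s ^+ 2 = ((`|H| + 2 * rho) / s) ^+ 2.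
    by rewrite exprMn exprVn.
  rewrite -real_normK ?num_real // lerXn2r ?nnegrE //.
  by rewrite divr_ge0 ?(ltW s_gt0) // addr_ge0 // mulr_ge0 // ltW.
have a6 : (h / s) ^+ 2 = h ^+ 2 / s ^+ 2 by rewrite exprMn exprVn.
have a7 : `|(J - (2^-1 * \int[mu]_(x in `[0, pi]) q x + cos_coef s / 2)) / s|
    <= C1 * A / s ^+ 2.
  rewrite normrM [`|s^-1|]ger0_norm ?invr_ge0 ?(ltW s_gt0) //.
  have -> : C1 * A / s ^+ 2 = C1 / s * A / s by field; exact: lt0r_neq0.
  by rewrite ler_pM2r ?invr_gt0.
have -> : pi * (s - n%:R) - (omega q h H + cos_coef s / 2) / s =
   (atan (bc_tan s) - bc_tan s) + (bc_tan s - H / s) + (atan (h / s) - h / s) +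
   (J - (2^-1 * \int[mu]_(x in `[0, pi]) q x + cos_coef s / 2)) / s.
  by rewrite E /omega; ring.
apply: (le_trans (ler_normD _ _)); rewrite [C2 / _]mulrDl; apply: lerD => //.
apply: (le_trans (ler_normD _ _)); rewrite [X in _ <= X]mulrDl; apply: lerD; last by rewrite -a6.
apply: (le_trans (ler_normD _ _)); rewrite [X in _ <= X]mulrDl; apply: lerD => //.
exact: le_trans a5.
Qed.

Local Notation y := (phi ^~ (s ^+ 2)).
Local Notation dy := (dphi ^~ (s ^+ 2)).

(** In the derivative of this energy the terms 2 y y' cancel, leaving 2 q y y'/s^2, at most |q|/s
    times v. So v is bounded uniformly in s, whereas the bound on y^2 + y'^2 in [ac_solution_energy]
    grows with |lam|. *)
Let v x := y x ^+ 2 + s^-1 ^+ 2 * dy x ^+ 2.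

Let v0 : v 0 = 1 + h ^+ 2 / s ^+ 2.
Proof. by have [_ p0 dp0] := phiP (s ^+ 2); rewrite /v p0 dp0 expr1n exprVn mulrC. Qed.

Let invs_le1 : s^-1 <= 1.
Proof. by rewrite invf_le1. Qed.

Let invs2_le : (s ^+ 2)^-1 <= s^-1.
Proof. by rewrite lef_pV2 ?posrE // expr2 ler_peMr // ltW. Qed.

Let v0_le : v 0 <= 1 + h ^+ 2.
Proof.
rewrite v0 lerD2l ler_piMr ?sqr_ge0 //.
exact: le_trans invs2_le invs_le1.
Qed.

Let ac_derive_v : ac_derive 0 pi v (fun x => s^-1 ^+ 2 * (2 * (y x * dy x)) * q x).
Proof.
have [yy dd] := phi_ac phiP (s ^+ 2).
have := ac_deriveD (ac_derive_sqr yy) (ac_deriveZ (s^-1 ^+ 2) (pi_ge0 R) (ac_derive_sqr dd)).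
by congr ac_derive; apply/funext => x; field; exact: lt0r_neq0.
Qed.

Let ydy_le x : `|2 * (y x * dy x)| * s^-1 <= v x.
Proof.
have -> : `|2 * (y x * dy x)| * s^-1 = 2 * `|y x| * (s^-1 * `|dy x|).
  by rewrite !normrM (ger0_norm (x := 2)) //; ring.
rewrite /v -(real_normK (num_real (y x))) -(real_normK (num_real (dy x))).
have := sqr_ge0 (`|y x| - s^-1 * `|dy x|).
by rewrite sqrrB exprMn mulr2n; lra.
Qed.

Let v_ge0 x : 0 <= v x.
Proof. by rewrite addr_ge0 ?sqr_ge0 // mulr_ge0 ?sqr_ge0. Qed.

Let dv_le x : `|s^-1 ^+ 2 * (2 * (y x * dy x)) * q x| <= s^-1 * `|q x| * v x.
Proof.
have -> : `|s^-1 ^+ 2 * (2 * (y x * dy x)) * q x| =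
    s^-1 * `|q x| * (`|2 * (y x * dy x)| * s^-1).
  rewrite 2!normrM [`|s^-1 ^+ 2|]ger0_norm ?sqr_ge0 //; ring.
by rewrite ler_wpM2l // mulr_ge0 // invr_ge0 ltW.
Qed.

Let V := (1 + h ^+ 2) * expR A.

Lemma solution_energy_le x : 0 <= x <= pi -> v x <= V.
Proof.
move=> xpi; have /andP[x0 xp] := xpi; have ab := pi_ge0 R.
have /andP[n0 n1] := normq_int_le qL2 xpi.
have sub := ac_derive_sub (lexx 0) xp.
have := ac_derive_gronwall x0 (sub _ _ (ac_deriveZ (-1) ab ac_derive_v))
  (sub _ _ (ac_deriveZ (- s^-1) ab (ac_derive_normq_int qL2))).
rewrite normq_int0 mulr0 expR0 => G; lapply G; last first.
  by apply: aeW => z _; have := dv_le z; rewrite ler_norml => /andP[_ +]; lra.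
set E := expR _ => {}G.
have EE : expR (s^-1 * normq_int q x) * E = 1 by rewrite -expRD mulNr subrr expR0.
have e0 : 0 <= expR (s^-1 * normq_int q x) := expR_ge0 _.
have vE : v x * E <= v 0 by lra.
have : v x <= v 0 * expR (s^-1 * normq_int q x).
  have := ler_wpM2l e0 vE; rewrite mulrCA EE mulr1 mulrC; lra.
move=> /le_trans; apply; apply: ler_pM => //.
by rewrite ler_expR (le_trans _ n1) // ler_piMl.
Qed.

Let C6 := h ^+ 2 + V * A.

(** Second pass: the bound [V], free of s, put back into v' makes it O(|q|/s), and v(0) = 1 +
    h^2/s^2. *)
Lemma solution_energy_near1 x : 0 <= x <= pi -> `|v x - 1| <= C6 / s.
Proof.
move=> xpi; have /andP[x0 xp] := xpi; have ab := pi_ge0 R.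
have /andP[n0 n1] := normq_int_le qL2 xpi.
have sub := ac_derive_sub (lexx 0) xp.
have V0 : 0 <= V by rewrite mulr_ge0 ?expR_ge0 // addr_ge0 ?sqr_ge0.
have nq := ac_deriveZ (s^-1 * V) ab (ac_derive_normq_int qL2).
have key z : z \in `]0, x[ ->
    `|s^-1 ^+ 2 * (2 * (y z * dy z)) * q z| <= s^-1 * V * `|q z|.
  rewrite in_itv /= => /andP[z0 zx]; apply: (le_trans (dv_le z)).
  rewrite -[leRHS]mulrAC ler_wpM2l ?mulr_ge0 ?invr_ge0 ?(ltW s_gt0) //.
  by apply: solution_energy_le; apply/andP; split; lra.
have := ac_derive_le x0 (sub _ _ (ac_deriveD nq ac_derive_v)).
have := ac_derive_le x0 (sub _ _ (ac_deriveD nq (ac_deriveZ (-1) ab ac_derive_v))).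
move=> h1 h2; lapply h1; last first.
  by apply: aeW => z zx; have := key z zx; rewrite ler_norml => /andP[? ?]; lra.
lapply h2; last first.
  by apply: aeW => z zx; have := key z zx; rewrite ler_norml => /andP[? ?]; lra.
rewrite normq_int0 /= v0 => {}h1 {}h2.
have h3 : h ^+ 2 / s ^+ 2 <= h ^+ 2 / s by rewrite ler_wpM2l ?sqr_ge0.
have h4 : 0 <= h ^+ 2 / s ^+ 2 by rewrite divr_ge0 ?sqr_ge0 // ltW.
have h5 : s^-1 * V * normq_int q x <= V * A / s.
  have -> : V * A / s = s^-1 * V * A by ring.
  by rewrite ler_wpM2l // mulr_ge0 // invr_ge0 ltW.
by rewrite ler_norml [C6 / s]mulrDl; apply/andP; split; lra.
Qed.

Let V_ge0 : 0 <= V.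
Proof. by rewrite mulr_ge0 ?expR_ge0 // addr_ge0 ?sqr_ge0. Qed.

Let y2_le x : 0 <= x <= pi -> y x ^+ 2 <= V.
Proof.
move=> /solution_energy_le; apply: le_trans.
by rewrite /v lerDl mulr_ge0 ?sqr_ge0.
Qed.

(** In polar form y y'/s = v sin(psi) cos(psi), with v close to 1 and psi close to s x + pi/2; the
    quarter turn produces the minus sign in front of sin(2 s x)/2. *)
Lemma solution_product_approx x psi : psi 0 = pi / 2 - atan (h / s) ->
  ac_derive 0 pi psi (fun x => s - sin (psi x) ^+ 2 / s * q x) ->
  (exists2 r : R, 0 < r & s * y x = r * sin (psi x) /\ dy x = r * cos (psi x)) ->
  0 <= x <= pi ->
  `|y x * dy x / s + sin (2 * s * x) / 2| <= (C6 + C1) / s.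
Proof.
move=> psi0 pp [r r0 [e1 e2]] xpi.
have yE : y x = r * sin (psi x) / s by rewrite -e1 [s * _]mulrC mulfK // lt0r_neq0.
have vE : v x = r ^+ 2 / s ^+ 2.
  rewrite /v yE e2; transitivity (r ^+ 2 / s ^+ 2 * (cos (psi x) ^+ 2 + sin (psi x) ^+ 2)).
    by field; exact: lt0r_neq0.
  by rewrite cos2Dsin2 mulr1.
have -> : y x * dy x / s + sin (2 * s * x) / 2 =
    (v x - 1) * (sin (psi x) * cos (psi x)) +
    (sin (psi x) * cos (psi x) - sin (s * x + pi / 2) * cos (s * x + pi / 2)).
  rewrite sinDpihalf cosDpihalf (_ : 2 * s * x = (s * x) *+ 2); last first.
    by rewrite -[RHS]mulr_natl mulrA.
  by rewrite sin_mulr2n vE yE e2; field; exact: lt0r_neq0.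
apply: (le_trans (ler_normD _ _)); rewrite [(C6 + C1) / s]mulrDl; apply: lerD.
  rewrite normrM -[leRHS]mulr1; apply: ler_pM => //; first exact: solution_energy_near1.
  by rewrite normrM -[leRHS]mulr1 ler_pM ?sin_max ?cos_max.
by apply: (le_trans (sin_cos_lipschitz _ _)); exact: angle_approx.
Qed.

Let charac_s : (s ^+ 2 - H1) * dy pi + (s ^+ 2 * H - H2) * y pi = 0.
Proof. by have := lambda_charac qL2 phiP lambda_range n.+1; rewrite lambda_s. Qed.

(** A solution in general only has y' = O(s). At an eigenvalue y'(pi) = -s [bc_tan s] y(pi), and
    [bc_tan s] = O(1/s). *)
Let boundary_product : `|y pi * dy pi| <= (`|H| + 2 * rho) * V.
Proof.
have pipi : 0 <= (pi : R) <= pi by rewrite pi_ge0 lexx.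
have -> : y pi * dy pi = - (bc_tan s * s) * y pi ^+ 2.
  apply: (mulfI (lt0r_neq0 den_gt0)).
  transitivity (y pi * ((s ^+ 2 - H1) * dy pi)); first by ring.
  rewrite (_ : (s ^+ 2 - H1) * dy pi = - ((s ^+ 2 * H - H2) * y pi)); last by have := charac_s; lra.
  by rewrite /bc_tan; field; rewrite !lt0r_neq0.
rewrite normrM; apply: ler_pM => //; last by rewrite ger0_norm ?sqr_ge0 // y2_le.
rewrite normrN normrM (ger0_norm (ltW s_gt0)) -ler_pdivlMr //; exact: bc_tan_small.
Qed.

(** The boundary condition turns y' + H y at pi into -rho y/(s^2 - H1). The term is even O(1/s^4);
    O(1/s^2) is enough. *)
Let boundary_term : (dy pi + H * y pi) ^+ 2 / rho <= 4 * rho * V / s ^+ 2.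
Proof.
have pipi : 0 <= (pi : R) <= pi by rewrite pi_ge0 lexx.
have -> : (dy pi + H * y pi) ^+ 2 / rho = rho * y pi ^+ 2 / (s ^+ 2 - H1) ^+ 2.
  have -> : dy pi + H * y pi = - rho * y pi / (s ^+ 2 - H1).
    apply: (mulIf (lt0r_neq0 den_gt0)); rewrite divfK ?lt0r_neq0 //.
    transitivity ((s ^+ 2 - H1) * dy pi + (s ^+ 2 * H - H2) * y pi - rho * y pi); first by ring.
    by rewrite charac_s sub0r mulNr.
  by field; rewrite !lt0r_neq0.
have s21 : 1 <= s ^+ 2 by rewrite expr_ge1 // ltW.
have -> : 4 * rho * V / s ^+ 2 = rho * V * (4 / s ^+ 2) by ring.
apply: ler_pM.
- by rewrite mulr_ge0 ?sqr_ge0 // ltW.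
- by rewrite invr_ge0 sqr_ge0.
- by rewrite ler_pM2l // y2_le.
rewrite -[4]invrK -invfM lef_pV2 ?posrE ?exprn_gt0 ?mulr_gt0 ?invr_gt0 //.
have h1 : (s ^+ 2 / 2) ^+ 2 <= (s ^+ 2 - H1) ^+ 2.
  by rewrite lerXn2r ?nnegrE ?(ltW den_gt0) // divr_ge0 // ltW.
apply: le_trans h1.
have -> : (s ^+ 2 / 2) ^+ 2 = 4^-1 * s ^+ 2 * s ^+ 2 by field.
by rewrite ler_peMr // mulr_ge0 ?invr_ge0 // ltW.
Qed.

Let C7 := (pi * h ^+ 2 + `|h| + (`|H| + 2 * rho) * V) / 2 + pi * (C6 + C1) * A + V * A / 2
  + 4 * rho * V.

Lemma norming_first :
  `|norming_constant H H1 H2 y dy - pi / 2 + sin_coef s / (2 * s)| <= C7 / s ^+ 2.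
Proof.
have ab := pi_ge0 R; have pipi : 0 <= (pi : R) <= pi by rewrite pi_ge0 lexx.
have H1s : H1 < s ^+ 2 by rewrite -subr_gt0.
have [_ p0 dp0] := phiP (s ^+ 2).
have [psi [psi0 pp lift psipi]] := eigenvalue_angle s_gt0 H1s lambda_s.
have [yy dd] := phi_ac phiP (s ^+ 2).
have cy := ac_derive_within yy; have cdy := ac_derive_within dd.
have iq := L2_0pi_integrable qL2.
have cc (k : R) : cont (fun=> k) := @within_continuous_cst R _ k.
have cpx : cont (fun x : R => pi - x).
  by apply: continuous_subspaceT => x; apply: cvgB; [exact: cvg_cst|exact: cvg_id].
have cy2 : cont (fun x => y x ^+ 2) := within_continuousT_comp (@exprn_continuous R 2) cy.
have cydy : cont (fun x => y x * dy x / s).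
  by apply: within_continuousM => //; exact: within_continuousM.
have cg : cont (fun x => (pi - x) * (y x * dy x / s)) by exact: within_continuousM.
have iy2 : mu.-integrable `[0, pi] (EFin \o (fun x => y x ^+ 2)).
  exact: integrable_within_continuous.
pose I1 := \int[mu]_(x in `[0, pi]) ((pi - x) * (y x * dy x / s) * q x).
pose I2 := \int[mu]_(x in `[0, pi]) (y x ^+ 2 * q x).
have ig : mu.-integrable `[0, pi] (EFin \o (fun x => (pi - x) * (y x * dy x / s) * q x)).
  exact: integrable_within_continuousM.
have iy2q : mu.-integrable `[0, pi] (EFin \o (fun x => y x ^+ 2 * q x)).
  exact: integrable_within_continuousM.
pose g1 x := 2 / s * ((pi - x) * (y x * dy x / s) * q x).
pose g2 x := s^-1 ^+ 2 * (y x ^+ 2 * q x).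
have i1 : mu.-integrable `[0, pi] (EFin \o g1) by apply: (integrableZl _ (2 / s) ig).
have i2 : mu.-integrable `[0, pi] (EFin \o g2) by apply: (integrableZl _ (s^-1 ^+ 2) iy2q).
have i3 : mu.-integrable `[0, pi] (EFin \o (fun x => 2 * y x ^+ 2)).
  by apply: (integrableZl _ 2 iy2).
have i31 : mu.-integrable `[0, pi] (EFin \o (fun x => 2 * y x ^+ 2 - g1 x)).
  by apply: (integrableB _ i3 i1).
have i312 : mu.-integrable `[0, pi] (EFin \o (fun x => 2 * y x ^+ 2 - g1 x - g2 x)).
  by apply: (integrableB _ i31 i2).
(* Subtracting y y'/s^2 cancels y'^2/s^2 from v and adds a second y^2. The weight x - pi vanishes at
   pi, so v contributes only pi v(0), where v(0) is explicit. *)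
have FF : ac_derive 0 pi (fun x => (x + - pi) * v x + (- s^-1 ^+ 2) * (y x * dy x))
    (fun x => 2 * y x ^+ 2 - g1 x - g2 x).
  have := ac_deriveD
    (ac_deriveM ab (ac_deriveD (ac_derive_id 0 pi) (ac_derive_cst 0 pi (- pi))) ac_derive_v)
    (ac_deriveZ (- s^-1 ^+ 2) ab (ac_deriveM ab yy dd)).
  congr ac_derive; apply/funext => x; rewrite /g1 /g2 /v; field; exact: lt0r_neq0.
have := ac_derive_FTC ab FF i312.
rewrite RintegralB // RintegralB // !RintegralZl // -/I1 -/I2 /= subrr mul0r add0r v0 p0 dp0.
set I0 := \int[mu]_(x in _) _ => FE.
have I1E : `|I1 + sin_coef s / 2| <= pi * ((C6 + C1) / s) * A.
  have isc : mu.-integrable `[0, pi] (EFin \o (fun x => (pi - x) * sin (2 * s * x) * q x)).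
    by apply: integrable_within_continuousM => //; exact: cont_sin.
  have cs2 : cont (fun x => - 2^-1 * ((pi - x) * sin (2 * s * x))).
    by apply: within_continuousM => //; exact: cont_sin.
  have -> : sin_coef s / 2 =
      - \int[mu]_(x in `[0, pi]) (- 2^-1 * ((pi - x) * sin (2 * s * x)) * q x).
    rewrite (_ : \int[mu]_(x in _) _ = - 2^-1 * sin_coef s); first by ring.
    by rewrite /sin_coef -RintegralZl //; apply: eq_Rintegral => x _; rewrite mulrA.
  apply: integral_mul_potentialB => // x xpi; have /andP[x0 xp] := xpi.
  have -> : (pi - x) * (y x * dy x / s) - - 2^-1 * ((pi - x) * sin (2 * s * x)) =
    (pi - x) * (y x * dy x / s + sin (2 * s * x) / 2) by ring.
  rewrite normrM; apply: ler_pM => //.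
    by rewrite ger0_norm ?subr_ge0 // gerBl.
  exact: solution_product_approx (lift x xpi) xpi.
have I2E : `|I2| <= V * A.
  by apply: integral_mul_potential_le => // x xpi; rewrite ger0_norm ?sqr_ge0 // y2_le.
have bt0 : 0 <= (dy pi + H * y pi) ^+ 2 / rho by rewrite divr_ge0 ?sqr_ge0 // ltW.
have bt := boundary_term; have bp := boundary_product.
have -> : norming_constant H H1 H2 y dy - pi / 2 + sin_coef s / (2 * s) =
  (pi * h ^+ 2 + h - y pi * dy pi) / 2 / s ^+ 2 + (I1 + sin_coef s / 2) / s + I2 / 2 / s ^+ 2 +
  (dy pi + H * y pi) ^+ 2 / rho.
  have I0E : I0 = pi / 2 + (pi * h ^+ 2 + h - y pi * dy pi) / 2 / s ^+ 2 + I1 / s + I2 / 2 / s ^+ 2.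
    have : 2 * I0 = 2 / s * I1 + s^-1 ^+ 2 * I2 + (- s^-1 ^+ 2 * (y pi * dy pi) -
      ((0 + - pi) * (1 + h ^+ 2 / s ^+ 2) + - s^-1 ^+ 2 * (1 * h))) by lra.
    move=> E; apply: (mulfI (x := 2)) => //; rewrite E; field; exact: lt0r_neq0.
  rewrite /norming_constant -/I0 I0E; field; rewrite !lt0r_neq0 //.
have is2 : 0 < (s ^+ 2)^-1 by rewrite invr_gt0.
rewrite [C7 / _]mulrDl; apply: (le_trans (ler_normD _ _)); apply: lerD; last by rewrite ger0_norm.
rewrite [X in _ <= X]mulrDl; apply: (le_trans (ler_normD _ _)); apply: lerD; last first.
  rewrite normrM (ger0_norm (ltW is2)) ler_pM2r // normrM (ger0_norm (x := 2^-1)) ?invr_ge0 //.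
  by rewrite ler_pM2r ?invr_gt0.
rewrite [X in _ <= X]mulrDl; apply: (le_trans (ler_normD _ _)); apply: lerD; last first.
  rewrite normrM [`|s^-1|]ger0_norm ?invr_ge0 ?(ltW s_gt0) //.
  have -> : pi * (C6 + C1) * A / s ^+ 2 = pi * ((C6 + C1) / s) * A / s.
    by field; exact: lt0r_neq0.
  by rewrite ler_pM2r ?invr_gt0.
rewrite normrM (ger0_norm (ltW is2)) ler_pM2r // normrM (ger0_norm (x := 2^-1)) ?invr_ge0 //.
rewrite ler_pM2r ?invr_gt0 //.
apply: (le_trans (ler_normB _ _)); apply: lerD => //.
apply: (le_trans (ler_normD _ _)); rewrite lerD2r ger0_norm // mulr_ge0 ?sqr_ge0 //.
Qed.

End AtLargeEigenvalue.

(** The form fed to the summability criterion: a coefficient at the integer n plus a multiple of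
    1/(n + 1). The eigenvalue of index n + 1 has root near n, so the factor is n + 1 but the
    frequency is n. *)
Lemma eigenvalue_asymptotics : exists C S0 : R, [/\ 0 <= C, 0 < S0 & forall (n : nat) (s : R),
  S0 <= s -> lambda n.+1 = s ^+ 2 ->
  `|n.+1%:R * (s - n%:R) - omega q h H / pi| <= `|cos_coef n%:R| + C / n.+1%:R /\
  `|n.+1%:R * (norming_constant H H1 H2 (phi ^~ (s ^+ 2)) (dphi ^~ (s ^+ 2)) - pi / 2)|
    <= `|sin_coef n%:R| + C / n.+1%:R].
Proof.
(* The explicit constants contain neither n nor s, which [eexists] verifies. *)
have [C2 C2P] : exists C2 : R, forall n s, 1 <= s -> 2 * `|H1| <= s ^+ 2 ->
    lambda n.+1 = s ^+ 2 ->
    `|pi * (s - n%:R) - (omega q h H + cos_coef s / 2) / s| <= C2 / s ^+ 2.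
  by eexists => n s s1 sH ls; exact: sqrt_eigenvalue_first.
have [C7 C7P] : exists C7 : R, forall n s, 1 <= s -> 2 * `|H1| <= s ^+ 2 ->
    lambda n.+1 = s ^+ 2 ->
    `|norming_constant H H1 H2 (phi ^~ (s ^+ 2)) (dphi ^~ (s ^+ 2)) - pi / 2 +
      sin_coef s / (2 * s)| <= C7 / s ^+ 2.
  by eexists => n s s1 sH ls; apply: (norming_first s1 sH ls).
have pi2 := pi_ge2 R; have pi0 := pi_gt0 R.
(* [W0] bounds omega + cos_coef/2, and then |s - n| <= D/s. The threshold chosen below gives s >= 1,
   2 |H1| <= s^2 and n + 1 <= 2 s. *)
pose W0 := `|omega q h H| + A; pose D := W0 + `|C2|.
have W00 : 0 <= W0 by rewrite addr_ge0.
have D0 : 0 <= D by rewrite addr_ge0.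
pose C5 := 2 * `|C2| + W0 * (1 + D) + 2 * pi * D * A.
pose C8 := 2 * `|C7| + pi * (2 * pi * D) * A.
have C50 : 0 <= C5.
  by do ?[done|exact: (ltW pi0)|apply: mulr_ge0|apply: addr_ge0].
have C80 : 0 <= C8.
  by do ?[done|exact: (ltW pi0)|apply: mulr_ge0|apply: addr_ge0].
exists (2 * (C5 + C8)), (1 + 2 * `|H1| + D); split.
- by rewrite mulr_ge0 // addr_ge0.
- by have := normr_ge0 H1; lra.
move=> n s sS ls; have nH := normr_ge0 H1.
have s1 : 1 <= s by lra.
have s0 : 0 < s by lra.
have sH : 2 * `|H1| <= s ^+ 2.
  by apply: (@le_trans _ _ s); [lra|rewrite expr2 ler_peMr // ltW].
have is0 : 0 < s^-1 by rewrite invr_gt0.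
have is2 : (s ^+ 2)^-1 <= s^-1 by rewrite lef_pV2 ?posrE ?exprn_gt0 // expr2 ler_peMr // ltW.
have E1 := C2P n s s1 sH ls; have E2 := C7P n s s1 sH ls.
set N : R := n.+1%:R; have NE : N = n%:R + 1 by rewrite /N -natr1.
have N0 : 0 < N by rewrite ltr0n.
set W := omega q h H + cos_coef s / 2 in E1.
have cA : `|cos_coef s| <= A.
  rewrite -[A]mul1r; apply: integral_mul_potential_le => // x _; exact: cos_max.
have WW : `|W| <= W0.
  apply: (le_trans (ler_normD _ _)); rewrite lerD2l normrM (ger0_norm (x := 2^-1)) ?invr_ge0 //.
  by have := normr_ge0 (cos_coef s); lra.
have Cs k : k / s ^+ 2 <= `|k| / s.
  apply: (@le_trans _ _ (`|k| / s ^+ 2)).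
    by rewrite ler_wpM2r ?ler_norm // invr_ge0 ltW // exprn_gt0.
  by rewrite ler_wpM2l.
have sn : `|s - n%:R| <= D / s.
  have h1 : `|pi * (s - n%:R)| <= D / s.
    rewrite -[X in `|X|](subrK (W / s)); apply: (le_trans (ler_normD _ _)).
    rewrite [D / s]mulrDl addrC; apply: lerD; last exact: le_trans E1 (Cs _).
    by rewrite normrM [`|s^-1|]ger0_norm ?(ltW is0) // ler_pM2r.
  apply: le_trans h1; rewrite normrM (ger0_norm (ltW pi0)).
  by rewrite ler_peMl //; lra.
have Ds : D / s <= D by rewrite ler_piMr // invf_le1.
have Ns : `|N - s| <= 1 + D.
  have -> : N - s = 1 + - (s - n%:R) by rewrite NE; ring.
  by apply: (le_trans (ler_normD _ _)); rewrite normrN normr1 lerD2l (le_trans sn).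
have N2s : N <= 2 * s.
  by have := ler_norm (N - s); lra.
have Ns2 : N / s <= 2 by rewrite ler_pdivrMr.
have Nis0 : 0 <= N / s by rewrite divr_ge0 // ltW.
have isN k : 0 <= k -> k / s <= 2 * k / N.
  move=> k0; rewrite ler_pdivlMr //; have -> : k / s * N = k * (N / s) by ring.
  by rewrite [2 * k]mulrC ler_wpM2l.
have NCs k : N * `|k / s ^+ 2| <= 2 * `|k| / s.
  rewrite normrM [`|(s ^+ 2)^-1|]ger0_norm ?invr_ge0 ?sqr_ge0 //.
  have -> : N * (`|k| / s ^+ 2) = N / s * (`|k| / s) by field; exact: lt0r_neq0.
  by rewrite -[leRHS]mulrA ler_wpM2r // divr_ge0 // ltW.
have ipi1 : pi^-1 <= 1 :> R by rewrite invf_le1 //; lra.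
have ipi0 : 0 <= pi^-1 :> R by rewrite invr_ge0 ltW.
have fin k : 0 <= k -> k <= C5 + C8 -> k / s <= 2 * (C5 + C8) / N.
  move=> k0 kC; apply: (le_trans (isN _ k0)); rewrite ler_pM2r ?invr_gt0 //.
  by rewrite ler_pM2l.
split.
  set E := pi * (s - n%:R) - W / s in E1.
  (* Replacing N/s by 1 costs the middle term, of order 1/s; the last term is the coefficient that
     remains. *)
  have -> : N * (s - n%:R) - omega q h H / pi =
    N * E / pi + W / pi * ((N - s) / s) + cos_coef s / 2 / pi.
    by rewrite /E /W; move: pi0; generalize (pi : R) => p p0; field; rewrite !lt0r_neq0.
  apply: (@le_trans _ _ (`|cos_coef n%:R| + C5 / s)); last first.
    by rewrite lerD2l; apply: fin => //; rewrite lerDl.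
  have h1 : `|N * E / pi| <= 2 * `|C2| / s.
    rewrite normrM (ger0_norm ipi0) -[leRHS]mulr1; apply: ler_pM => //.
    rewrite normrM (ger0_norm (ltW N0)); apply: le_trans (NCs C2).
    by rewrite ler_pM2l // (le_trans E1) // ler_norm.
  have h2 : `|W / pi * ((N - s) / s)| <= W0 * (1 + D) / s.
    rewrite normrM [`|(N - s) / s|]normrM [`|s^-1|]ger0_norm ?(ltW is0) // mulrA ler_pM2r //.
    apply: ler_pM => //; rewrite normrM (ger0_norm ipi0) -[leRHS]mulr1; exact: ler_pM.
  have h3 : `|cos_coef s / 2 / pi| <= `|cos_coef n%:R| + 2 * pi * D * A / s.
    apply: (@le_trans _ _ `|cos_coef s|).
      have hp0 : 0 <= 2^-1 * pi^-1 :> R by lra.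
      have hp : 2^-1 * pi^-1 <= 1 :> R by lra.
      by rewrite -mulrA normrM (ger0_norm hp0) ler_piMr.
    have := ler_normD (cos_coef s - cos_coef n%:R) (cos_coef n%:R); rewrite subrK.
    have := cos_coef_lipschitz s n%:R.
    have : 2 * pi * `|s - n%:R| * A <= 2 * pi * D * A / s.
      have -> : 2 * pi * D * A / s = 2 * pi * (D / s) * A by ring.
      by rewrite ler_wpM2r // ler_wpM2l // mulr_ge0 ?ltW.
    lra.
  apply: (le_trans (ler_normD _ _)).
  have := ler_normD (N * E / pi) (W / pi * ((N - s) / s)).
  by rewrite /C5; lra.
set G := norming_constant _ _ _ _ _ - pi / 2 in E2 *.
apply: (@le_trans _ _ (`|sin_coef n%:R| + C8 / s)); last first.
  by rewrite lerD2l; apply: fin => //; rewrite lerDr.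
have -> : N * G = N * (G + sin_coef s / (2 * s)) - N / s / 2 * sin_coef s.
  by field; exact: lt0r_neq0.
have h1 : `|N * (G + sin_coef s / (2 * s))| <= 2 * `|C7| / s.
  rewrite normrM (ger0_norm (ltW N0)); apply: le_trans (NCs C7).
  by rewrite ler_pM2l // (le_trans E2) // ler_norm.
have h2 : `|N / s / 2 * sin_coef s| <= `|sin_coef s|.
  have hN0 : 0 <= N / s / 2 by lra.
  have hN1 : N / s / 2 <= 1 by lra.
  by rewrite normrM (ger0_norm hN0) ler_piMl.
have h3 : `|sin_coef s| <= `|sin_coef n%:R| + pi * (2 * pi * D) * A / s.
  have := ler_normD (sin_coef s - sin_coef n%:R) (sin_coef n%:R); rewrite subrK.
  have := sin_coef_lipschitz s n%:R.
  have : pi * (2 * pi * `|s - n%:R|) * A <= pi * (2 * pi * D) * A / s.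
    have -> : pi * (2 * pi * D) * A / s = pi * (2 * pi * (D / s)) * A by ring.
    by rewrite ler_wpM2r // !ler_wpM2l // ?mulr_ge0 ?ltW.
  lra.
by apply: (le_trans (ler_normB _ _)); rewrite /C8; lra.
Qed.

End Asymptotics.

(** * Bessel's inequality and square summability *)

Section Bessel.
Context {R : realType}.
Local Notation mu := (@lebesgue_measure R).
Local Notation cont f := {within `[0, pi], continuous f}.

(** The modes are not normalised: cos(2 k x) has squared norm pi for k = 0 and pi/2 otherwise, and
    sin(2 k x) vanishes for k = 0. The common upper bound pi for the squared norms gives the bound
    pi times the squared norm of a q. *)
Lemma bessel (q a : R -> R) (e : nat -> R -> R) : L2_0pi q -> cont a ->
  (forall k, cont (e k)) ->
  (forall j k, j != k -> \int[mu]_(x in `[0, pi]) (e j x * e k x) = 0) ->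
  (forall k x, `|e k x| <= 1) ->
  exists B : R, forall K : nat,
    \sum_(k < K) (\int[mu]_(x in `[0, pi]) (a x * e k x * q x)) ^+ 2 <= B.
Proof.
move=> qL2 ca ce orth e1; have pi0 := pi_gt0 R; have ab := pi_ge0 R.
have mI : measurable (`[0, pi]%classic : set R) by exact: measurable_itv.
have cc (k : R) : cont (fun=> k) := @within_continuous_cst R _ k.
have cM (f g : R -> R) : cont f -> cont g -> cont (fun x => f x * g x) :=
  @within_continuousM R _ f g.
have cD (f g : R -> R) : cont f -> cont g -> cont (fun x => f x + g x) :=
  @within_continuousD _ _ _ _ f g.
have iQ (b : R -> R) : cont b ->
    mu.-integrable `[0, pi] (EFin \o (fun x => (a x * q x + b x) ^+ 2)).
  move=> cb; have := integrable_quadratic qL2 (cM _ _ ca ca)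
    (cM _ _ (cc 2) (cM _ _ ca cb)) (cM _ _ cb cb).
  by apply: eq_integrable => // x _ /=; congr EFin; ring.
have iE (b : R -> R) k : cont b ->
    mu.-integrable `[0, pi] (EFin \o (fun x => (a x * q x + b x) * e k x)).
  move=> cb; have := integrable_affine qL2 (cM _ _ ca (ce k)) (cM _ _ cb (ce k)).
  by apply: eq_integrable => // x _ /=; congr EFin; ring.
have iee j k : mu.-integrable `[0, pi] (EFin \o (fun x => e j x * e k x)).
  by apply: integrable_within_continuous; exact: cM.
pose c k := \int[mu]_(x in `[0, pi]) (a x * e k x * q x).
pose I0 := \int[mu]_(x in `[0, pi]) (a x * q x + 0) ^+ 2.
have ee k : \int[mu]_(x in `[0, pi]) (e k x * e k x) <= pi.
  have i1 : mu.-integrable `[0, pi] (EFin \o cst (1 : R)).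
    exact: (integrable_within_continuous (cc 1)).
  have i1E : \int[mu]_(x in `[0, pi]) (cst (1 : R) x) = pi.
    by rewrite (ac_derive_FTC ab (ac_derive_id 0 pi) i1) subr0.
  rewrite -[leRHS]i1E; apply: le_Rintegral => // x _.
  by rewrite -expr2 -real_normK ?num_real // expr_le1.
(* The residual a q + b arises from a q by subtracting multiples of the first K modes; by
   orthogonality it keeps the later coefficients. *)
suff H K : exists2 b : R -> R, cont b &
    (forall k, (K <= k)%N -> \int[mu]_(x in `[0, pi]) ((a x * q x + b x) * e k x) = c k) /\
    \sum_(k < K) c k ^+ 2 <= pi * (I0 - \int[mu]_(x in `[0, pi]) (a x * q x + b x) ^+ 2).
  exists (pi * I0) => K; have [b cb [_]] := H K; move/le_trans; apply.
  by rewrite ler_pM2l // gerBl Rintegral_ge0 // => x _; exact: sqr_ge0.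
elim: K => [|K [b cb [bE bS]]].
  exists (fun=> 0) => //; split; last by rewrite big_ord0 /I0 subrr mulr0.
  by move=> k _; apply: eq_Rintegral => x _; ring.
(* Dividing by pi rather than by the squared norm of e K avoids a zero denominator. As that norm is
   at most pi, the squared norm of the residual still drops by at least (c K)^2/pi. *)
pose al := c K / pi.
exists (fun x => b x + - al * e K x); first by apply: (cD) => //; exact: cM.
have iae k : mu.-integrable `[0, pi] (EFin \o (fun x => al * (e K x * e k x))).
  by apply: (integrableZl _ al (iee K k)).
split.
  move=> k Kk; rewrite -(bE k (ltnW Kk)).
  transitivity (\int[mu]_(x in `[0, pi]) ((a x * q x + b x) * e k x - al * (e K x * e k x))).
    by apply: eq_Rintegral => x _; ring.
  rewrite RintegralB //; last exact: iE.
  by rewrite RintegralZl // orth ?mulr0 ?subr0 // neq_ltn Kk.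
have iae2 : mu.-integrable `[0, pi] (EFin \o (fun x => al ^+ 2 * (e K x * e K x))).
  by apply: (integrableZl _ (al ^+ 2) (iee K K)).
have iaE : mu.-integrable `[0, pi] (EFin \o (fun x => 2 * al * ((a x * q x + b x) * e K x))).
  by apply: (integrableZl _ (2 * al) (iE b K cb)).
have iB : mu.-integrable `[0, pi] (EFin \o (fun x => (a x * q x + b x) ^+ 2 -
    2 * al * ((a x * q x + b x) * e K x))).
  by apply: (integrableB _ (iQ b cb) iaE).
have -> : \int[mu]_(x in `[0, pi]) (a x * q x + (b x + - al * e K x)) ^+ 2 =
    \int[mu]_(x in `[0, pi]) (a x * q x + b x) ^+ 2 - 2 * al * c K +
    al ^+ 2 * \int[mu]_(x in `[0, pi]) (e K x * e K x).
  transitivity (\int[mu]_(x in `[0, pi]) ((a x * q x + b x) ^+ 2 -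
    2 * al * ((a x * q x + b x) * e K x) + al ^+ 2 * (e K x * e K x))).
    by apply: eq_Rintegral => x _; ring.
  rewrite RintegralD // RintegralB //; last exact: iQ.
  rewrite !RintegralZl //; last exact: iE.
  by rewrite bE.
rewrite big_ord_recr /=.
have cE : c K ^+ 2 = pi * (2 * al * c K - al ^+ 2 * pi).
  have pn0 : pi != 0 :> R by rewrite lt0r_neq0.
  rewrite /al; move: pn0; generalize (pi : R) => p p0; field.
  exact: p0.
have h1 : al ^+ 2 * \int[mu]_(x in `[0, pi]) (e K x * e K x) <= al ^+ 2 * pi.
  by rewrite ler_wpM2l ?sqr_ge0.
rewrite cE; apply: (le_trans (lerD bS (lexx _))); rewrite -mulrDr ler_pM2l //; lra.
Qed.

Lemma integral_cos_eq0 (t : R) : t != 0 -> sin (t * pi) = 0 ->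
  \int[mu]_(x in `[0, pi]) cos (t * x) = 0.
Proof.
move=> t0 st; have ab := pi_ge0 R.
have ct : cont (fun x : R => cos (t * x)) := within_continuous_scale (@continuous_cos R).
have ss := ac_deriveZ t^-1 ab (ac_derive_comp ab (@is_derive_sin R) (@continuous_cos R)
  (ac_deriveZ t ab (ac_derive_id 0 pi))).
have cs : ac_derive 0 pi (fun x => t^-1 * sin (t * x)) (fun x => cos (t * x)).
  by apply: (ac_derive_ext ss) => x _; rewrite mulr1 mulrC mulfK.
by rewrite (ac_derive_FTC ab cs (integrable_within_continuous ct)) st !mulr0 sin0 mulr0 subr0.
Qed.

Lemma integral_cos_even (j k : nat) : j != k ->
  \int[mu]_(x in `[0, pi]) cos ((2 * j%:R - 2 * k%:R) * x) = 0 /\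
  \int[mu]_(x in `[0, pi]) cos ((2 * j%:R + 2 * k%:R) * x) = 0.
Proof.
move=> jk.
have s2 (m : nat) : sin (2 * m%:R * pi) = 0 :> R by rewrite -natrM sin_natpi.
split; apply: integral_cos_eq0.
- by rewrite -mulrBr mulf_neq0 // subr_eq0 eqr_nat.
- by rewrite mulrBl sinB !s2 mul0r mulr0 subr0.
- rewrite -mulrDr mulf_neq0 // -natrD pnatr_eq0 addn_eq0.
  by apply: contra jk => /andP[/eqP -> /eqP ->].
- by rewrite mulrDl sinD !s2 mul0r mulr0 addr0.
Qed.

End Bessel.

(** * Trigonometric coefficients and square summability *)

Section SquareSummability.
Context {R : realType}.
Local Notation mu := (@lebesgue_measure R).

(** The product formula as a hypothesis treats the cosine (ep = 1/2) and the sine (ep = -1/2) at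
    once. *)
Lemma orthogonal_even_trig (f : R -> R) (ep : R) (j k : nat) :
  (forall a b, f a * f b = 2^-1 * cos (a - b) + ep * cos (a + b)) -> j != k ->
  \int[mu]_(x in `[0, pi]) (f (2 * j%:R * x) * f (2 * k%:R * x)) = 0.
Proof.
move=> fE jk; have [h1 h2] := @integral_cos_even R j k jk.
have ic t : mu.-integrable `[0, pi] (EFin \o (fun x => cos (t * x))).
  exact: integrable_within_continuous (within_continuous_scale (@continuous_cos R)).
have mI : measurable (`[0, pi]%classic : set R) by exact: measurable_itv.
transitivity (\int[mu]_(x in `[0, pi]) (2^-1 * cos ((2 * j%:R - 2 * k%:R) * x) +
    ep * cos ((2 * j%:R + 2 * k%:R) * x))).
  by apply: eq_Rintegral => x _; rewrite fE -mulrBl -mulrDl.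
have i1 : mu.-integrable `[0, pi] (EFin \o (fun x => 2^-1 * cos ((2 * j%:R - 2 * k%:R) * x))).
  by apply: (integrableZl _ 2^-1 (ic _)).
have i2 : mu.-integrable `[0, pi] (EFin \o (fun x => ep * cos ((2 * j%:R + 2 * k%:R) * x))).
  by apply: (integrableZl _ ep (ic _)).
rewrite RintegralD // !RintegralZl ?h1 ?h2 ?mulr0 ?addr0 //; exact: ic.
Qed.

Lemma cos_coef_bessel (q : R -> R) : L2_0pi q ->
  exists B : R, forall K : nat, \sum_(k < K) cos_coef q k%:R ^+ 2 <= B.
Proof.
move=> qL2.
have [||||B HB] := @bessel R q (fun=> 1) (fun k x => cos (2 * k%:R * x)) qL2.
- exact: (@within_continuous_cst R _ 1).
- by move=> k; exact: within_continuous_scale (@continuous_cos R).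
- move=> j k; apply: (orthogonal_even_trig (ep := 2^-1)) => a b.
  by rewrite cosB cosD; lra.
- by move=> k x; exact: cos_max.
exists B => K; apply: le_trans (HB K); rewrite le_eqVlt; apply/orP; left; apply/eqP.
by apply: eq_bigr => k _; congr (_ ^+ 2); apply: eq_Rintegral => x _; rewrite mul1r.
Qed.

Lemma sin_coef_bessel (q : R -> R) : L2_0pi q ->
  exists B : R, forall K : nat, \sum_(k < K) sin_coef q k%:R ^+ 2 <= B.
Proof.
move=> qL2; apply: (@bessel R q (fun x => pi - x) (fun k x => sin (2 * k%:R * x)) qL2).
- by apply: continuous_subspaceT => x; apply: cvgB; [exact: cvg_cst|exact: cvg_id].
- by move=> k; exact: within_continuous_scale (@continuous_sin R).
- move=> j k; apply: (orthogonal_even_trig (ep := - 2^-1)) => a b.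
  by rewrite cosB cosD; lra.
- by move=> k x; exact: sin_max.
Qed.

Lemma sum_invsqr_le (K : nat) : \sum_(k < K) (k.+1%:R ^+ 2)^-1 <= 2 :> R.
Proof.
(* The sharper bound telescopes: 1/(a + 1)^2 <= 1/a - 1/(a + 1). *)
suff H : \sum_(k < K.+1) (k.+1%:R ^+ 2)^-1 <= 2 - K.+1%:R^-1 :> R.
  apply: le_trans (le_trans H _); last by rewrite gerBl invr_ge0.
  by rewrite big_ord_recr /= lerDl invr_ge0 sqr_ge0.
elim: K => [|K IH]; first by rewrite big_ord_recr big_ord0 /= expr1n invr1; lra.
rewrite big_ord_recr /=; apply: (le_trans (lerD IH (lexx _))).
have a0 : 0 < K.+1%:R :> R by rewrite ltr0n.
rewrite -[K.+2%:R]natr1; set a : R := K.+1%:R in a0 *.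
have a1 : 0 < a + 1 by lra.
rewrite -subr_ge0.
have -> : 2 - (a + 1)^-1 - (2 - a^-1 + ((a + 1) ^+ 2)^-1) = (a * (a + 1) ^+ 2)^-1.
  by field; rewrite !lt0r_neq0.
by rewrite invr_ge0 mulr_ge0 ?sqr_ge0 // ltW.
Qed.

Lemma l2_seq_of_bound (z : nat -> R[i]) (c : nat -> R) (B C : R) (N : nat) :
  (forall K : nat, \sum_(k < K) c k ^+ 2 <= B) ->
  (forall n, (N <= n)%N -> Normc.normc (z n.+1) <= `|c n| + C / n.+1%:R) ->
  l2_seq z.
Proof.
move=> cB zc; pose u n := Normc.normc (z n) ^+ 2.
have u0 n : 0 <= u n by exact: sqr_ge0.
pose S := \sum_(n < N.+1) u n.
(* The hypothesis controls z only from index N + 1 on, so the first N + 1 terms are set aside in S.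
   The factors 2 come from (a + t)^2 <= 2 a^2 + 2 t^2. *)
have uS m : \sum_(n < N.+1 + m) u n <=
    S + 2 * \sum_(k < N + m) c k ^+ 2 + 2 * C ^+ 2 * \sum_(k < N + m) (k.+1%:R ^+ 2)^-1.
  elim: m => [|m IH].
    have c0 : 0 <= \sum_(k < N) c k ^+ 2 by apply: sumr_ge0 => k _; exact: sqr_ge0.
    have i0 : 0 <= \sum_(k < N) (k.+1%:R ^+ 2)^-1 :> R.
      by apply: sumr_ge0 => k _; rewrite invr_ge0 sqr_ge0.
    rewrite !addn0 -/S -addrA lerDl; apply: addr_ge0; first by rewrite mulr_ge0.
    by apply: mulr_ge0 => //; rewrite mulr_ge0 ?sqr_ge0.
  have r (f : nat -> R) p : \sum_(n < p.+1) f n = \sum_(n < p) f n + f p.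
    by rewrite big_ord_recr.
  rewrite !addnS (r u) (r (fun k => c k ^+ 2)) (r (fun k => (k.+1%:R ^+ 2)^-1)).
  apply: (le_trans (lerD IH (lexx _))).
  have h : u (N + m).+1 <= 2 * c (N + m)%N ^+ 2 + 2 * C ^+ 2 * ((N + m).+1%:R ^+ 2)^-1.
    have nz : 0 <= Normc.normc (z (N + m).+1) by case: (z _) => x y /=; exact: sqrtr_ge0.
    have := zc (N + m)%N (leq_addr _ _); set w := _ + _ => zw.
    apply: (@le_trans _ _ (w ^+ 2)); first by rewrite lerXn2r ?nnegrE // (le_trans nz).
    have -> : 2 * C ^+ 2 * ((N + m).+1%:R ^+ 2)^-1 = 2 * (C / (N + m).+1%:R) ^+ 2.
      by rewrite exprMn exprVn -!mulrA.
    rewrite -(real_normK (num_real (c _))) /w.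
    move: (C / _) `|c _| => t a; have := sqr_ge0 (a - t).
    by rewrite sqrrB sqrrD; lra.
  rewrite addSn; move: h; move: (u _) (_^-1) (\sum_(k < _) _^-1) (\sum_(k < _) _ ^+ 2).
  by move=> *; lra.
pose M := S + 2 * B + 2 * C ^+ 2 * 2.
have uM K : \sum_(n < K) u n <= M.
  apply: (@le_trans _ _ (\sum_(n < N.+1 + K) u n)).
    by rewrite (addnC N.+1) big_split_ord /= lerDl sumr_ge0.
  apply: (le_trans (uS K)); rewrite /M; apply: lerD; last first.
    by apply: ler_wpM2l; [rewrite mulr_ge0 ?sqr_ge0|exact: sum_invsqr_le].
  by rewrite lerD2l ler_pM2l.
rewrite /l2_seq; apply: (@le_lt_trans _ _ M%:E); last exact: ltry.
apply: lime_le.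
  by apply: is_cvg_nneseries => n _ _; rewrite lee_fin; exact: u0.
by apply: nearW => K; rewrite sumEFin lee_fin big_mkord; exact: uM.
Qed.

End SquareSummability.

Lemma normc_real {R : realType} (x : R) : Normc.normc (x%:C)%C = `|x|.
Proof. by rewrite /Normc.normc /= expr0n /= addr0 sqrtr_sqr. Qed.

Local Open Scope complex_scope.

Theorem theorem2p1 (R : realType) (q : R -> R) (h H H1 H2 : R)
    (phi dphi : R -> R -> R) (lambda gamma : nat -> R) :
  L2_0pi q ->
  0 < H * H1 - H2 ->
  (* phi(x, lam), with x-derivative dphi(x, lam) *)
  (forall lam : R,
     [/\ SL_solution q lam (phi ^~ lam) (dphi ^~ lam),
         phi 0 lam = 1 & dphi 0 lam = h]) ->
  (* lambda_0 < lambda_1 < ... are all the eigenvalues *)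
  (forall m n : nat, (m < n)%N -> lambda m < lambda n) ->
  [set lam | SL_eigenvalue q h H H1 H2 lam] = range lambda ->
  (forall n : nat, gamma n =
     norming_constant H H1 H2 (phi ^~ (lambda n)) (dphi ^~ (lambda n))) ->
  exists zeta zeta' : nat -> R[i],
    [/\ l2_seq zeta, l2_seq zeta' &
        forall n : nat, (1 <= n)%N ->
          sqrtc (lambda n)%:C =
            (n%:R - 1 + omega q h H / (n%:R * pi))%:C + zeta n / n%:R
          /\ (gamma n)%:C = (pi / 2)%:C + zeta' n / n%:R].
Proof.
move=> qL2 rho0 phiP lambda_lt lambda_range gammaE.
have [C [S0 [C0 S00 asym]]] := eigenvalue_asymptotics qL2 rho0 phiP lambda_lt lambda_range.
have [N NP] := eigenvalue_unbounded qL2 rho0 phiP lambda_lt lambda_range (S0 ^+ 2).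
have [Bc HBc] := cos_coef_bessel qL2; have [Bs HBs] := sin_coef_bessel qL2.
pose w n : R := n%:R - 1 + omega q h H / (n%:R * pi).
(* Both sequences are defined by solving the asymptotic formulas, which therefore hold for all n >=
   1, also where the root is imaginary. Only a tail bound remains, and there [lambda] exceeds S0^2,
   so the root is real. *)
pose zeta n : R[i] := n%:R * (sqrtc (lambda n)%:C - (w n)%:C).
pose zeta' n : R[i] := n%:R * ((gamma n)%:C - (pi / 2)%:C).
have main n : (N <= n)%N ->
    Normc.normc (zeta n.+1) <= `|cos_coef q n%:R| + C / n.+1%:R /\
    Normc.normc (zeta' n.+1) <= `|sin_coef q n%:R| + C / n.+1%:R.
  move=> Nn; have ln := NP n.+1 (leqW Nn).
  have l0 : 0 <= lambda n.+1 by apply: le_trans (ltW ln); exact: sqr_ge0.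
  pose s := Num.sqrt (lambda n.+1).
  have sE : lambda n.+1 = s ^+ 2 by rewrite sqr_sqrtr.
  have S0s : S0 <= s by rewrite -(ler_pXn2r (ltn0Sn 1)) ?nnegrE ?sqrtr_ge0 ?(ltW S00) // -sE ltW.
  have [h1 h2] := asym n s S0s sE.
  have n0 : n.+1%:R != 0 :> R by rewrite pnatr_eq0.
  split.
    have -> : zeta n.+1 = (n.+1%:R * (s - w n.+1))%:C.
      by rewrite rmorphM rmorphB /= rmorph_nat /zeta sqrtc_sqrtr ?lecR.
    rewrite normc_real; move: h1; congr (`|_| <= _).
    rewrite /w; have pn0 : pi != 0 :> R by rewrite lt0r_neq0 // pi_gt0.
    rewrite -natr1 in n0 *; move: pn0 n0; generalize (pi : R) => p p0 n0; field.
    by rewrite p0 n0.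
  have -> : zeta' n.+1 = (n.+1%:R * (gamma n.+1 - pi / 2))%:C.
    by rewrite rmorphM rmorphB /= rmorph_nat.
  by rewrite normc_real gammaE sE.
exists zeta, zeta'; split.
- apply: (@l2_seq_of_bound R zeta (fun k => cos_coef q k%:R) Bc C N HBc) => n Nn.
  by have [] := main n Nn.
- apply: (@l2_seq_of_bound R zeta' (fun k => sin_coef q k%:R) Bs C N HBs) => n Nn.
  by have [] := main n Nn.
move=> n n1; have n0 : n%:R != 0 :> R[i] by rewrite pnatr_eq0 -lt0n.
by split; rewrite /zeta /zeta' [_ * _ / _]mulrAC mulfV // mul1r addrC subrK.
Qed.
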